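(* Let $\mathcal{E}:\mathbb{N}\to\mathbf{Topos}$ be a stratified topos and $\Box:\mathcal{E}\to\mathcal{E}$ a stratified Cartesian comonad. Then the functor $\mathcal{E}^{\Box}:\mathbb{N}\to\mathbf{Topos}$ given on objects $n\in\mathbb{N}$ by $\mathcal{E}^{\Box}(n)=\mathcal{E}(n)^{(\Box_n)}$ (the category of coalgebras of the comonad $\Box_n$ on $\mathcal{E}(n)$), with the evident action $(A,a)\mapsto(iA,ia)$ on $m\le n$ where $i:\mathcal{E}(m)\to\mathcal{E}(n)$ is the functorial action of $\mathcal{E}$, is again a stratified topos.
   Context: Topos means elementary topos. A Cartesian category is a category equipped with a choice of finite limits; a Cartesian functor is one preserving finite limits; a full subcategory of a Cartesian category is a Cartesian full subcategory if it is closed under the chosen finite limits. $\mathbf{Topos}$ is the $2$-category of small toposes, Cartesian functors and natural transformations. $\mathbb{N}$ is the poset of natural numbers regarded as a category. $\mathbf{Topos}^{\mathbb{N}}$ is the $2$-category of $2$-functors $\mathbb{N}\to\mathbf{Topos}$ ($\mathbb{N}$ being locally discrete), $2$-natural transformations, and modifications. Limits in categories of coalgebras for a Cartesian comonad are chosen so that the forgetful functor preserves the choice strictly. Logical subtopos: when $\mathcal{F}$ is a topos, a logical subtopos of $\mathcal{F}$ is a full subcategory closed under a choice of topos structure (finite limits, exponentials, subobject classifier) in $\mathcal{F}$. Locally small maps: for $\mathbf{C}$ a Cartesian full subcategory of $\mathbf{D}$, a morphism $p:E\to B$ of $\mathbf{D}$ is locally $\mathbf{C}$-small if for every $A\in\mathbf{C}$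 and $f:A\to B$ there is a pullback of $p$ along $f$ whose vertex lies in $\mathbf{C}$ (by convention, the chosen pullback $f^*E$ then lies in $\mathbf{C}$). A generic locally $\mathbf{C}$-small map is a locally $\mathbf{C}$-small map such that every locally $\mathbf{C}$-small map is a pullback of it. Sheaves and stacks: let $i:\mathbf{C}\hookrightarrow\mathbf{D}$ be a full subcategory inclusion of small categories. A $\mathbf{D}$-indexed category is a contravariant pseudofunctor from $\mathbf{D}$ to categories; $\mathbf{IndCat}(\mathbf{D})$ is the $2$-category of small ones (i.e. with small values), with pseudonatural transformations and modifications; $i^*$ denotes precomposition with $i$. An object $X\in\mathbf{D}$ is a sheaf on $(\mathbf{D},\mathbf{C})$ if for every $I\in\mathbf{D}$ the map $\mathrm{Hom}_{\mathbf{D}}(I,X)\to\mathrm{Nat}(\mathrm{Hom}_{\mathbf{D}}(i(-),I),\mathrm{Hom}_{\mathbf{D}}(i(-),X))$, $g\mapsto(f\mapsto g\circ f)$, is bijective. A small $\mathbf{D}$-indexed category $P$ is a stack on $(\mathbf{D},\mathbf{C})$ if for every $I\in\mathbf{D}$ the functor $P(I)\to\mathrm{Hom}_{\mathbf{IndCat}(\mathbf{C})}(i^*(\mathrm{y}I),i^*P)$ (with $\mathrm{y}I=\mathrm{Hom}_{\mathbf{D}}(-,I)$ regarded as discrete), sending $e$ to the family $(f:J\to I)\mapsto P(f)(e)$ with its evident coherences, is an equivalence of categories. Dense logical subtopos: a logical subtopos $\mathcal{E}$ of a small topos $\mathcal{F}$ is dense if (1) every object of $\mathcal{F}$ is a sheaf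 on $(\mathcal{F},\mathcal{E})$, and (2) the self-indexing $\mathcal{F}/(-)$ (slices, with reindexing by pullback) is a stack on $(\mathcal{F},\mathcal{E})$. Stratified topos: a functor $\mathcal{E}:\mathbb{N}\to\mathbf{Topos}$ such that for all $m\le n$ the action $\mathcal{E}(m)\to\mathcal{E}(n)$ is the inclusion of a dense logical subtopos, and for all $m<n$ there is a generic locally $\mathcal{E}(m)$-small map in $\mathcal{E}(n)$. Morphism of sites: for Cartesian full subcategories $\mathbf{C}\subseteq\mathbf{D}$ and $\mathbf{E}\subseteq\mathbf{F}$, a Cartesian functor $G:\mathbf{D}\to\mathbf{F}$ is a morphism of sites $(\mathbf{D},\mathbf{C})\to(\mathbf{F},\mathbf{E})$ if for every $D\in\mathbf{D}$ and $f:E\to GD$ in $\mathbf{F}$ with $E\in\mathbf{E}$ there is $g:C\to D$ in $\mathbf{D}$ with $C\in\mathbf{C}$ such that $f$ factors through $Gg$. Stratified Cartesian functor: for stratified toposes $\mathcal{E},\mathcal{F}$, a morphism $F:\mathcal{E}\to\mathcal{F}$ of $\mathbf{Topos}^{\mathbb{N}}$ such that for all $m\le n$, $F_n:\mathcal{E}(n)\to\mathcal{F}(n)$ is a morphism of sites $(\mathcal{E}(n),\mathcal{E}(m))\to(\mathcal{F}(n),\mathcal{F}(m))$. Stratified Cartesian comonad on a stratified topos $\mathcal{E}$: a comonad $\Box:\mathcal{E}\to\mathcal{E}$ in the $2$-category $\mathbf{Topos}^{\mathbb{N}}$ whose underlying morphism is a stratified Cartesian functor. (Thus each $\Box_n$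 is a finite-limit-preserving comonad on $\mathcal{E}(n)$, and these commute strictly, together with counits and comultiplications, with the inclusions $\mathcal{E}(m)\to\mathcal{E}(n)$.) *)

(* Defs.v *)
From mathcomp Require Import all_boot.
From mathcomp Require Import boolp.

Set Implicit Arguments.
Unset Strict Implicit.
Unset Printing Implicit Defensive.

Declare Scope cat_scope.
Delimit Scope cat_scope with cat.
Local Open Scope cat_scope.
#[local] Obligation Tactic := idtac.

(* The universe of [Category] is fixed, and small means living in it.
   Functional extensionality and proof irrelevance hold (see [boolp]), so
   Leibniz equality of functors, modifications and so on is the strict
   equality of ordinary category theory. *)
Record Category : Type := {
  Ob :> Type;
  Hom : Ob -> Ob -> Type;
  idm : forall A, Hom A A;
  comp : forall A B C, Hom B C -> Hom A B -> Hom A C;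
  comp_idl : forall A B (f : Hom A B), comp (idm B) f = f;
  comp_idr : forall A B (f : Hom A B), comp f (idm A) = f;
  comp_assoc : forall A B C D (h : Hom C D) (g : Hom B C) (f : Hom A B),
    comp h (comp g f) = comp (comp h g) f }.

Arguments Hom {c} _ _.
Arguments idm {c} A.
Arguments comp {c A B C} _ _.

Notation "A ~> B" := (Hom A B) (at level 90, right associativity) : cat_scope.
Notation "g ∘ f" := (comp g f) (at level 40, left associativity) : cat_scope.

(* Equality of morphisms whose sources and targets are only propositionally
   equal. *)
Inductive heq (C : Category) (A B : C) (f : A ~> B) :
    forall A' B' : C, (A' ~> B') -> Prop :=
  heq_refl : heq f f.

(* The identity, seen as a morphism between propositionally equal objects. *)
Definition idto (C : Category) (A B : C) (e : A = B) : A ~> B :=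
  match e in _ = B' return A ~> B' with erefl => idm A end.

Definition is_iso (C : Category) (A B : C) (f : A ~> B) : Prop :=
  exists g : B ~> A, g ∘ f = idm A /\ f ∘ g = idm B.

Definition monic (C : Category) (A B : C) (f : A ~> B) : Prop :=
  forall (X : C) (g h : X ~> A), f ∘ g = f ∘ h -> g = h.

Record Functor (C D : Category) : Type := {
  fob :> C -> D;
  fmap : forall A B : C, (A ~> B) -> (fob A ~> fob B);
  fmap_id : forall A, fmap (idm A) = idm (fob A);
  fmap_comp : forall A B X (g : B ~> X) (f : A ~> B),
    fmap (g ∘ f) = fmap g ∘ fmap f }.

Arguments fmap {C D} f {A B} _ : rename.

Definition idF (C : Category) : Functor C C :=
  {| fob := fun A => A; fmap := fun A B f => f;
     fmap_id := fun A => erefl; fmap_comp := fun A B X g f => erefl |}.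

Program Definition compF (C D E : Category) (G : Functor D E) (F : Functor C D) :
    Functor C E :=
  {| fob := fun A => G (F A); fmap := fun A B f => fmap G (fmap F f) |}.
Next Obligation. by move=> C D E G F A /=; rewrite !fmap_id. Qed.
Next Obligation. by move=> C D E G F A B X g f /=; rewrite !fmap_comp. Qed.

Notation "G ∘F F" := (compF G F) (at level 40, left associativity) : cat_scope.

Record NatTrans (C D : Category) (F G : Functor C D) : Type := {
  nt :> forall A, F A ~> G A;
  nt_nat : forall A B (f : A ~> B), nt B ∘ fmap F f = fmap G f ∘ nt A }.

Record NatIso (C D : Category) (F G : Functor C D) : Type := {
  ni :> NatTrans F G;
  ni_iso : forall A, is_iso (ni A) }.

Definition is_equivalence (C D : Category) (F : Functor C D) : Prop :=
  exists G : Functor D C,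
    inhabited (NatIso (idF C) (G ∘F F)) /\ inhabited (NatIso (F ∘F G) (idF D)).

Lemma castE (C : Category) (A B : C) (f : A ~> B) (A' B' : C) (g : A' ~> B') :
  heq f g -> forall (eA : A' = A) (eB : B' = B),
  f = idto eB ∘ g ∘ idto (esym eA).
Proof.
case=> eA eB; rewrite (Prop_irrelevance eA erefl) (Prop_irrelevance eB erefl) /=.
by rewrite comp_idl comp_idr.
Qed.

Lemma heq_eq (C : Category) (A B : C) (f g : A ~> B) : heq f g -> f = g.
Proof. by move=> h; rewrite (castE h erefl erefl) /= comp_idl comp_idr. Qed.

Lemma heq_sym (C : Category) (A B A' B' : C) (f : A ~> B) (g : A' ~> B') :
  heq f g -> heq g f.
Proof. by case. Qed.

Lemma heq_trans (C : Category) (A B A' B' A'' B'' : C) (f : A ~> B)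
  (g : A' ~> B') (h : A'' ~> B'') : heq f g -> heq g h -> heq f h.
Proof. by case. Qed.

Lemma eq_heq (C : Category) (A B : C) (f g : A ~> B) : f = g -> heq f g.
Proof. by move->. Qed.

Lemma heq_idto (C : Category) (A B : C) (e : A = B) : heq (idto e) (idm A).
Proof. by case: _ / e. Qed.

Lemma heq_idtol (C : Category) (A B B' : C) (e : B = B') (f : A ~> B) :
  heq (idto e ∘ f) f.
Proof. by case: _ / e; rewrite /= comp_idl. Qed.

Lemma heq_idtor (C : Category) (A A' B : C) (e : A' = A) (f : A ~> B) :
  heq (f ∘ idto e) f.
Proof. by case: _ / e f => f; rewrite /= comp_idr. Qed.

Lemma heq_comp (C : Category) (A B X A' B' X' : C) (g : B ~> X) (f : A ~> B)
  (g' : B' ~> X') (f' : A' ~> B') :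
  B = B' -> heq g g' -> heq f f' -> heq (g ∘ f) (g' ∘ f').
Proof.
have h1 : forall (A1 B1 : C) (f1 : A1 ~> B1), heq f f1 ->
    forall e : B1 = B, heq (g ∘ f) (g ∘ (idto e ∘ f1)).
  by move=> A1 B1 f1 [] e; rewrite (Prop_irrelevance e erefl) /= comp_idl.
move=> eB hg; move: f' (esym eB); case: _ _ _ / hg => f' e /h1.
by move=> /(_ erefl); rewrite /= comp_idl.
Qed.

Lemma functor_ext (C D : Category) (F G : Functor C D) :
  (forall A, F A = G A) ->
  (forall A B (f : A ~> B), heq (fmap F f) (fmap G f)) -> F = G.
Proof.
case: F G => [F0 F1 Fi Fc] [G0 G1 Gi Gc] /= e0.
have {}e0 : F0 = G0 by apply: funext.
case: _ / e0 G1 Gi Gc => G1 Gi Gc h.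
have e1 : F1 = G1.
  apply: functional_extensionality_dep => A.
  apply: functional_extensionality_dep => B.
  by apply: funext => f; exact: heq_eq.
case: _ / e1 Gi Gc {h} => Gi Gc.
by rewrite (Prop_irrelevance Fi Gi) (Prop_irrelevance Fc Gc).
Qed.

Lemma natTrans_ext (C D : Category) (F G : Functor C D) (a b : NatTrans F G) :
  (forall A, a A = b A) -> a = b.
Proof.
case: a b => [a na] [b nb] /= h.
have e : a = b by apply: functional_extensionality_dep.
by case: _ / e nb {h} => nb; rewrite (Prop_irrelevance na nb).
Qed.

Lemma fmap_idto (C D : Category) (F : Functor C D) (A B : C) (e : A = B) :
  heq (fmap F (idto e)) (idm (F A)).
Proof. by case: _ / e; rewrite /= fmap_id. Qed.

Lemma heq_fmap (C D : Category) (F : Functor C D) (A B A' B' : C)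
  (f : A ~> B) (g : A' ~> B') : heq f g -> heq (fmap F f) (fmap F g).
Proof. by case. Qed.

Lemma heq_nt (C D : Category) (F G : Functor C D) (a : NatTrans F G) (A B : C) :
  A = B -> heq (a A) (a B).
Proof. by move->. Qed.

Lemma heq_functor (C D : Category) (F G : Functor C D) (A B : C) (f : A ~> B) :
  F = G -> heq (fmap F f) (fmap G f).
Proof. by move->. Qed.

Definition is_terminal (C : Category) (T : C) : Prop :=
  forall A : C, exists f : A ~> T, forall g : A ~> T, g = f.

(*   P --p2--> B
     |         |
     p1        g
     v         v
     A --f---> X   *)
Definition is_pullback (C : Category) (A B X : C) (f : A ~> X) (g : B ~> X)
    (P : C) (p1 : P ~> A) (p2 : P ~> B) : Prop :=
  f ∘ p1 = g ∘ p2 /\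
  forall (Q : C) (q1 : Q ~> A) (q2 : Q ~> B), f ∘ q1 = g ∘ q2 ->
    exists! h : Q ~> P, p1 ∘ h = q1 /\ p2 ∘ h = q2.

(* A choice of finite limits, presented by a terminal object and pullbacks. *)
Record FinLimits (C : Category) : Type := {
  top : C;
  top_terminal : is_terminal top;
  pb : forall A B X : C, (A ~> X) -> (B ~> X) -> C;
  pb1 : forall A B X (f : A ~> X) (g : B ~> X), pb f g ~> A;
  pb2 : forall A B X (f : A ~> X) (g : B ~> X), pb f g ~> B;
  pb_pullback : forall A B X (f : A ~> X) (g : B ~> X),
    is_pullback f g (pb1 f g) (pb2 f g) }.

Arguments top {C} _.
Arguments pb {C} _ {A B X} _ _.
Arguments pb1 {C} _ {A B X} _ _.
Arguments pb2 {C} _ {A B X} _ _.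
Arguments pb_pullback {C} _ {A B X} _ _.

Definition to_terminal (C : Category) (T : C) (hT : is_terminal T) (A : C) :
  A ~> T := proj1_sig (cid (hT A)).

Lemma to_terminal_uniq (C : Category) (T : C) (hT : is_terminal T) (A : C)
  (f g : A ~> T) : f = g.
Proof. by case: (hT A) => h u; rewrite (u f) (u g). Qed.

Section Gap.
Context (C : Category) (A B X : C) (f : A ~> X) (g : B ~> X).
Context (P : C) (p1 : P ~> A) (p2 : P ~> B) (hP : is_pullback f g p1 p2).

Definition gap (Q : C) (q1 : Q ~> A) (q2 : Q ~> B) (e : f ∘ q1 = g ∘ q2) :
  Q ~> P := proj1_sig (cid (hP.2 Q q1 q2 e)).

Lemma gap1 (Q : C) (q1 : Q ~> A) (q2 : Q ~> B) (e : f ∘ q1 = g ∘ q2) :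
  p1 ∘ gap e = q1.
Proof. by rewrite /gap; case: cid => h [[]]. Qed.

Lemma gap2 (Q : C) (q1 : Q ~> A) (q2 : Q ~> B) (e : f ∘ q1 = g ∘ q2) :
  p2 ∘ gap e = q2.
Proof. by rewrite /gap; case: cid => h [[]]. Qed.

Lemma pullback_jointly_monic (Q : C) (h k : Q ~> P) :
  p1 ∘ h = p1 ∘ k -> p2 ∘ h = p2 ∘ k -> h = k.
Proof.
move=> e1 e2.
have e : f ∘ (p1 ∘ h) = g ∘ (p2 ∘ h) by rewrite !comp_assoc hP.1.
case: (hP.2 Q _ _ e) => u [_ uu].
by rewrite -(uu h) // -(uu k).
Qed.
End Gap.

Definition to_top (C : Category) (L : FinLimits C) (A : C) : A ~> top L :=
  to_terminal (top_terminal L) A.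

Definition cprod (C : Category) (L : FinLimits C) (A B : C) : C :=
  pb L (to_top L A) (to_top L B).

Definition cfst (C : Category) (L : FinLimits C) (A B : C) : cprod L A B ~> A :=
  pb1 L (to_top L A) (to_top L B).

Definition csnd (C : Category) (L : FinLimits C) (A B : C) : cprod L A B ~> B :=
  pb2 L (to_top L A) (to_top L B).

Definition cpair (C : Category) (L : FinLimits C) (A B Q : C)
    (q1 : Q ~> A) (q2 : Q ~> B) : Q ~> cprod L A B :=
  gap (pb_pullback L (to_top L A) (to_top L B))
    (to_terminal_uniq (top_terminal L) (to_top L A ∘ q1) (to_top L B ∘ q2)).

Definition prod_map (C : Category) (L : FinLimits C) (X Y A : C) (g : X ~> Y) :
    cprod L X A ~> cprod L Y A :=
  cpair L (g ∘ cfst L X A) (csnd L X A).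

Record Exponentials (C : Category) (L : FinLimits C) : Type := {
  expo : C -> C -> C;
  ev : forall A B : C, cprod L (expo A B) A ~> B;
  exp_universal : forall (A B X : C) (f : cprod L X A ~> B),
    exists! g : X ~> expo A B, ev A B ∘ prod_map L A g = f }.

Record SubobjectClassifier (C : Category) (L : FinLimits C) : Type := {
  Omega : C;
  truth : top L ~> Omega;
  classify : forall (U X : C) (m : U ~> X), monic m ->
    exists! chi : X ~> Omega, is_pullback chi truth m (to_top L U) }.

Record ToposStructure (C : Category) : Type := {
  ts_lim : FinLimits C;
  ts_exp : Exponentials ts_lim;
  ts_sub : SubobjectClassifier ts_lim }.

Record CartCat : Type := {
  cc_cat :> Category;
  cc_lim : FinLimits cc_cat }.

Definition is_topos (C : CartCat) : Prop :=
  inhabited (Exponentials (cc_lim C)) /\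
  inhabited (SubobjectClassifier (cc_lim C)).

Definition cartesian_functor (C D : Category) (F : Functor C D) : Prop :=
  (forall T : C, is_terminal T -> is_terminal (F T)) /\
  (forall (A B X : C) (f : A ~> X) (g : B ~> X) (P : C) (p1 : P ~> A)
      (p2 : P ~> B),
    is_pullback f g p1 p2 ->
    is_pullback (fmap F f) (fmap F g) (fmap F p1) (fmap F p2)).

(* A functor is, up to renaming of objects, the inclusion of a full
   subcategory exactly when it satisfies the following; the subcategory is
   then its image, which need not be closed under isomorphism. *)
Definition full_inclusion (C D : Category) (i : Functor C D) : Prop :=
  injective i /\ forall A B : C, bijective (@fmap _ _ i A B).

Definition in_image (C D : Category) (i : Functor C D) (X : D) : Prop :=
  exists A : C, i A = X.

Definition closed_topos_structure (C D : Category) (i : Functor C D)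
    (S : ToposStructure D) : Prop :=
  [/\ in_image i (top (ts_lim S)),
      forall (A B X : D) (f : A ~> X) (g : B ~> X),
        in_image i A -> in_image i B -> in_image i X ->
        in_image i (pb (ts_lim S) f g),
      forall A B : D, in_image i A -> in_image i B ->
        in_image i (expo (ts_exp S) A B)
    & in_image i (Omega (ts_sub S))].

(* The topos structure witnessing closure is chosen anew for each inclusion;
   its finite limits need not be those of a [CartCat] structure on [D]. *)
Definition logical_subtopos (C D : Category) (i : Functor C D) : Prop :=
  full_inclusion i /\
  exists S : ToposStructure D, closed_topos_structure i S.

Definition locally_small (C D : Category) (i : Functor C D) (E B : D)
    (p : E ~> B) : Prop :=
  forall (A : C) (f : i A ~> B),
    exists (P : C) (q : i P ~> i A) (g : i P ~> E), is_pullback f p q g.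

Definition generic_locally_small (C D : Category) (i : Functor C D) (E B : D)
    (p : E ~> B) : Prop :=
  locally_small i p /\
  forall (E' B' : D) (p' : E' ~> B'), locally_small i p' ->
    exists (f : B' ~> B) (g : E' ~> E), is_pullback f p p' g.

(* The functor [G] is a morphism of sites from (D, image of i) to
   (F, image of j). *)
Definition morphism_of_sites (C D E F : Category) (i : Functor C D)
    (j : Functor E F) (G : Functor D F) : Prop :=
  cartesian_functor G /\
  forall (X : D) (Y : E) (f : j Y ~> G X),
    exists (A : C) (g : i A ~> X) (h : j Y ~> G (i A)), f = fmap G g ∘ h.

Record RestrictedYonedaHom (C D : Category) (i : Functor C D) (I X : D) : Type := {
  ry :> forall A : C, (i A ~> I) -> (i A ~> X);
  ry_nat : forall (A B : C) (u : A ~> B) (f : i B ~> I),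
    ry (f ∘ fmap i u) = ry f ∘ fmap i u }.

Program Definition restricted_yoneda (C D : Category) (i : Functor C D) (I X : D)
    (g : I ~> X) : RestrictedYonedaHom i I X :=
  {| ry := fun A f => g ∘ f |}.
Next Obligation. by move=> C D i I X g A B u f; rewrite /= comp_assoc. Qed.

Definition is_sheaf (C D : Category) (i : Functor C D) (X : D) : Prop :=
  forall I : D, bijective (@restricted_yoneda C D i I X).

(* A contravariant pseudofunctor from [D] to small categories.  The coherence
   laws use [heq] because [f ∘ idm J] and [f], for instance, are only
   propositionally equal. *)
Record IndexedCat (D : Category) : Type := {
  icat :> D -> Category;
  reindex : forall I J : D, (J ~> I) -> Functor (icat I) (icat J);
  iid : forall I : D, NatIso (idF (icat I)) (reindex (idm I));
  icomp : forall (I J K : D) (f : J ~> I) (g : K ~> J),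
    NatIso (reindex g ∘F reindex f) (reindex (f ∘ g));
  icomp_idl : forall (I J : D) (f : J ~> I) (X : icat I),
    heq (icomp (idm I) f X ∘ fmap (reindex f) (iid I X)) (idm (reindex f X));
  icomp_idr : forall (I J : D) (f : J ~> I) (X : icat I),
    heq (icomp f (idm J) X ∘ iid J (reindex f X)) (idm (reindex f X));
  icomp_assoc : forall (I J K L : D) (f : J ~> I) (g : K ~> J) (h : L ~> K)
      (X : icat I),
    heq (icomp (f ∘ g) h X ∘ fmap (reindex h) (icomp f g X))
        (icomp f (g ∘ h) X ∘ icomp g h (reindex f X)) }.

Arguments reindex {D} i {I J} _ : rename.
Arguments iid {D} i I : rename.
Arguments icomp {D} i {I J K} f g : rename.

Record PseudoNat (D : Category) (P Q : IndexedCat D) : Type := {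
  pn :> forall I : D, Functor (P I) (Q I);
  pn_iso : forall (I J : D) (f : J ~> I),
    NatIso (reindex Q f ∘F pn I) (pn J ∘F reindex P f);
  pn_id : forall (I : D) (X : P I),
    pn_iso (idm I) X ∘ iid Q I (pn I X) = fmap (pn I) (iid P I X);
  pn_comp : forall (I J K : D) (f : J ~> I) (g : K ~> J) (X : P I),
    pn_iso (f ∘ g) X ∘ icomp Q f g (pn I X) =
    fmap (pn K) (icomp P f g X) ∘ pn_iso g (reindex P f X)
      ∘ fmap (reindex Q g) (pn_iso f X) }.

Arguments pn_iso {D P Q} p {I J} f : rename.

Record Modification (D : Category) (P Q : IndexedCat D) (S T : PseudoNat P Q) :
    Type := {
  md :> forall I : D, NatTrans (S I) (T I);
  md_compat : forall (I J : D) (f : J ~> I) (X : P I),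
    md J (reindex P f X) ∘ pn_iso S f X =
    pn_iso T f X ∘ fmap (reindex Q f) (md I X) }.

Lemma modification_ext (D : Category) (P Q : IndexedCat D) (S T : PseudoNat P Q)
  (a b : Modification S T) : (forall I X, a I X = b I X) -> a = b.
Proof.
case: a b => [a ha] [b hb] /= h.
have e : a = b.
  by apply: functional_extensionality_dep => I; apply: natTrans_ext.
by case: _ / e hb {h} => hb; rewrite (Prop_irrelevance ha hb).
Qed.

Program Definition md_id (D : Category) (P Q : IndexedCat D) (S : PseudoNat P Q) :
    Modification S S :=
  {| md := fun I => {| nt := fun X => idm (S I X) |} |}.
Next Obligation. by move=> *; rewrite comp_idl comp_idr. Qed.
Next Obligation. by move=> * /=; rewrite fmap_id comp_idl comp_idr. Qed.

Program Definition md_comp (D : Category) (P Q : IndexedCat D)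
    (S T U : PseudoNat P Q) (b : Modification T U) (a : Modification S T) :
    Modification S U :=
  {| md := fun I => {| nt := fun X => b I X ∘ a I X |} |}.
Next Obligation.
by move=> D P Q S T U b a I A B f; rewrite -comp_assoc nt_nat !comp_assoc nt_nat.
Qed.
Next Obligation.
move=> D P Q S T U b a I J f X /=.
by rewrite -comp_assoc md_compat comp_assoc md_compat fmap_comp comp_assoc.
Qed.

Program Definition IndHom (D : Category) (P Q : IndexedCat D) : Category :=
  {| Ob := PseudoNat P Q; Hom := @Modification D P Q;
     idm := @md_id D P Q; comp := @md_comp D P Q |}.
Next Obligation.
by move=> *; apply: modification_ext => I X /=; rewrite comp_idl.
Qed.
Next Obligation.
by move=> *; apply: modification_ext => I X /=; rewrite comp_idr.
Qed.
Next Obligation.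
by move=> *; apply: modification_ext => I X /=; rewrite comp_assoc.
Qed.

Definition castNI (C D : Category) (A : Type) (R : A -> Functor C D)
    (F : Functor C D) (x y : A) (e : x = y) (a : NatIso F (R x)) :
    NatIso F (R y) :=
  match e in _ = y' return NatIso F (R y') with erefl => a end.

(* [i^* P].  The structural isomorphisms are cast along [fmap_id] and
   [fmap_comp], which are only propositional equalities. *)
Program Definition restrict (C D : Category) (i : Functor C D)
    (P : IndexedCat D) : IndexedCat C :=
  {| icat := fun I => P (i I);
     reindex := fun I J f => reindex P (fmap i f);
     iid := fun I => castNI (R := fun f => reindex P f) (esym (fmap_id i I))
                       (iid P (i I));
     icomp := fun I J K f g =>
       castNI (R := fun h => reindex P h) (esym (fmap_comp i f g))
         (icomp P (fmap i f) (fmap i g)) |}.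
Next Obligation.
move=> C D i P I J f X /=.
have := icomp_idl (fmap i f) X.
move: (esym (fmap_comp i (idm I) f)); case: _ / => /=.
by move: (fmap i (idm I)) (esym (fmap_id i I)) => h e; case: _ / e.
Qed.
Next Obligation.
move=> C D i P I J f X /=.
have := icomp_idr (fmap i f) X.
move: (esym (fmap_comp i f (idm J))); case: _ / => /=.
by move: (fmap i (idm J)) (esym (fmap_id i J)) => h e; case: _ / e.
Qed.
Next Obligation.
move=> C D i P I J K L f g h X /=.
have := icomp_assoc (fmap i f) (fmap i g) (fmap i h) X.
case: _ / (esym (fmap_comp i (f ∘ g) h)).
case: _ / (esym (fmap_comp i f (g ∘ h))).
move: (fmap i (f ∘ g)) (esym (fmap_comp i f g)) => u e; case: _ / e.
by move: (fmap i (g ∘ h)) (esym (fmap_comp i g h)) => v e; case: _ / e.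
Qed.

Program Definition discrete (T : Type) : Category :=
  {| Ob := T; Hom := fun x y => x = y; idm := fun x => erefl;
     comp := fun x y z f g => etrans g f |}.
Next Obligation. by move=> *; exact: Prop_irrelevance. Qed.
Next Obligation. by move=> *; exact: Prop_irrelevance. Qed.
Next Obligation. by move=> *; exact: Prop_irrelevance. Qed.

Lemma discrete_eq (T : Type) (x y : discrete T) (f g : x ~> y) : f = g.
Proof. exact: (@Prop_irrelevance (x = y :> T) f g). Qed.

Lemma discrete_iso (T : Type) (x y : discrete T) (f : x ~> y) : is_iso f.
Proof. by exists (esym f); split; exact: discrete_eq. Qed.

Lemma discrete_heq (T : Type) (x y x' y' : discrete T) (f : x ~> y)
  (g : x' ~> y') : x = x' -> heq f g.
Proof. by move=> e; case: _ / e g => g; case: _ / f g => g; case: _ / g. Qed.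

Program Definition discrete_map (S T : Type) (h : S -> T) :
    Functor (discrete S) (discrete T) :=
  {| fob := h : discrete S -> discrete T; fmap := fun x y e => congr1 h e |}.
Next Obligation. by move=> *; exact: discrete_eq. Qed.
Next Obligation. by move=> *; exact: discrete_eq. Qed.

Program Definition discrete_natIso (C : Category) (T : Type)
    (F G : Functor C (discrete T)) (e : forall x, F x = G x) : NatIso F G :=
  {| ni := {| nt := e |} |}.
Next Obligation. by move=> *; exact: discrete_eq. Qed.
Next Obligation. by move=> *; exact: discrete_iso. Qed.

Definition yoneda_reindex (D : Category) (I J K : D) (u : K ~> J) :
    Functor (discrete (J ~> I)) (discrete (K ~> I)) :=
  discrete_map (fun f : J ~> I => f ∘ u).

Definition yoneda_id (D : Category) (I J : D) :
    NatIso (idF (discrete (J ~> I))) (yoneda_reindex I (idm J)) :=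
  @discrete_natIso _ _ (idF (discrete (J ~> I))) (yoneda_reindex I (idm J))
    (fun f : J ~> I => esym (comp_idr f)).

Definition yoneda_comp (D : Category) (I J K L : D) (u : K ~> J) (v : L ~> K) :
    NatIso (yoneda_reindex I v ∘F yoneda_reindex I u) (yoneda_reindex I (u ∘ v)) :=
  @discrete_natIso _ _ (yoneda_reindex I v ∘F yoneda_reindex I u)
    (yoneda_reindex I (u ∘ v))
    (fun f : J ~> I => esym (comp_assoc f u v)).

(* The representable [D(-, I)] as an indexed category with discrete values. *)
Program Definition yoneda (D : Category) (I : D) : IndexedCat D :=
  {| icat := fun J => discrete (J ~> I);
     reindex := @yoneda_reindex D I;
     iid := @yoneda_id D I;
     icomp := @yoneda_comp D I |}.
Next Obligation. by move=> *; apply: discrete_heq. Qed.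
Next Obligation. by move=> *; apply: discrete_heq. Qed.
Next Obligation. by move=> *; apply: discrete_heq. Qed.

Program Definition discrete_functor (T : Type) (C : Category) (h : T -> C) :
    Functor (discrete T) C :=
  {| fob := h : discrete T -> C; fmap := fun x y e => idto (congr1 h e) |}.
Next Obligation. by []. Qed.
Next Obligation.
by move=> T C h x y z g f; case: _ / g; case: _ / f; rewrite /= comp_idl.
Qed.

Lemma discrete_natural (T : Type) (C : Category) (F G : Functor (discrete T) C)
  (a : forall x, F x ~> G x) (x y : discrete T) (f : x ~> y) :
  a y ∘ fmap F f = fmap G f ∘ a x.
Proof.
by case: _ / f; rewrite (fmap_id F x) (fmap_id G x) comp_idl comp_idr.
Qed.

Section Canonical.
Context (C D : Category) (i : Functor C D) (P : IndexedCat D) (I : D).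

Definition canonical_at (e : P I) (J : C) :
    Functor (restrict i (yoneda I) J) (restrict i P J) :=
  discrete_functor (fun f : i J ~> I => reindex P f e).

Program Definition canonical_iso (e : P I) (J K : C) (u : K ~> J) :
    NatIso (reindex (restrict i P) u ∘F canonical_at e J)
           (canonical_at e K ∘F reindex (restrict i (yoneda I)) u) :=
  {| ni := {| nt := fun f : i J ~> I => icomp P f (fmap i u) e |} |}.
Next Obligation. by move=> e J K u; apply: discrete_natural. Qed.
Next Obligation. by move=> e J K u f; exact: (ni_iso (icomp P (f : i J ~> I) (fmap i u)) e). Qed.

(* An object [e] of [P I] gives the pseudonatural transformation sending
   [f : i J ~> I] to [reindex P f e]. *)
Program Definition canonical_pn (e : P I) :
    PseudoNat (restrict i (yoneda I)) (restrict i P) :=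
  {| pn := canonical_at e; pn_iso := @canonical_iso e |}.
Next Obligation.
move=> e J f; apply: heq_eq.
apply: heq_trans (heq_sym (heq_idto _)) => /=.
have := icomp_idr f e.
by move: (fmap i (idm J)) (esym (fmap_id i J)) => h E; case: _ / E.
Qed.
Next Obligation.
move=> e J K L f g X; apply: heq_eq => /=.
have := icomp_assoc X (fmap i f) (fmap i g) e.
case: _ / (esym (fmap_comp i f g)) => /= h.
apply: heq_trans (heq_sym h) _.
apply: heq_trans (eq_heq (comp_assoc _ _ _)).
by apply: heq_sym; apply: heq_idtol.
Qed.

Program Definition canonical_md (e e' : P I) (x : e ~> e') :
    Modification (canonical_pn e) (canonical_pn e') :=
  {| md := fun J => {| nt := fun f : i J ~> I => fmap (reindex P f) x |} |}.
Next Obligation. by move=> e e' x J; apply: discrete_natural. Qed.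
Next Obligation.
move=> e e' x J K u f /=.
by rewrite (nt_nat (icomp P f (fmap i u)) x).
Qed.

Program Definition canonical :
    Functor (P I) (IndHom (restrict i (yoneda I)) (restrict i P)) :=
  {| fob := canonical_pn : P I -> IndHom _ _; fmap := canonical_md |}.
Next Obligation.
move=> e; apply: modification_ext => J f.
exact: (fmap_id (reindex P (f : i J ~> I)) e).
Qed.
Next Obligation.
move=> e e' e'' y x; apply: modification_ext => J f.
exact: (fmap_comp (reindex P (f : i J ~> I)) y x).
Qed.
End Canonical.

Definition is_stack (C D : Category) (i : Functor C D) (P : IndexedCat D) : Prop :=
  forall I : D, is_equivalence (canonical i P I).

Record SliceOb (C : Category) (I : C) : Type := {
  sdom : C;
  smap : sdom ~> I }.

Record SliceHom (C : Category) (I : C) (X Y : SliceOb I) : Type := {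
  sfun :> sdom X ~> sdom Y;
  sfun_comm : smap Y ∘ sfun = smap X }.

Lemma sliceHom_ext (C : Category) (I : C) (X Y : SliceOb I) (f g : SliceHom X Y) :
  sfun f = sfun g -> f = g.
Proof.
case: f g => [f hf] [g hg] /= e; case: _ / e hg => hg.
by rewrite (Prop_irrelevance hf hg).
Qed.

Program Definition slice (C : Category) (I : C) : Category :=
  {| Ob := SliceOb I; Hom := @SliceHom C I;
     idm := fun X => {| sfun := idm (sdom X) |};
     comp := fun X Y Z g f => {| sfun := sfun g ∘ sfun f |} |}.
Next Obligation. by move=> *; rewrite comp_idr. Qed.
Next Obligation. by move=> C I X Y Z g f; rewrite comp_assoc !sfun_comm. Qed.
Next Obligation. by move=> *; apply: sliceHom_ext; rewrite /= comp_idl. Qed.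
Next Obligation. by move=> *; apply: sliceHom_ext; rewrite /= comp_idr. Qed.
Next Obligation. by move=> *; apply: sliceHom_ext; rewrite /= comp_assoc. Qed.

Lemma slice_iso (C : Category) (I : C) (X Y : slice I) (f : X ~> Y)
  (g : sdom Y ~> sdom X) :
  g ∘ sfun f = idm _ -> sfun f ∘ g = idm _ -> is_iso f.
Proof.
move=> gf fg.
have hg : smap X ∘ g = smap Y.
  by rewrite -(sfun_comm f) -comp_assoc fg comp_idr.
by exists {| sfun := g; sfun_comm := hg |}; split; apply: sliceHom_ext.
Qed.

Section SelfIndexing.
Context (C : Category) (L : FinLimits C).

Definition slice_pb (I J : C) (f : J ~> I) (X : slice I) : slice J :=
  {| sdom := pb L (smap X) f; smap := pb2 L (smap X) f |}.

Definition slice_gap (I J : C) (f : J ~> I) (X : slice I) (A : slice J)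
    (u : sdom A ~> sdom X) (e : smap X ∘ u = f ∘ smap A) :
    A ~> slice_pb f X :=
  {| sfun := gap (pb_pullback L (smap X) f) e : sdom A ~> sdom (slice_pb f X);
     sfun_comm := gap2 (pb_pullback L (smap X) f) e |}.

Lemma slice_gap1 (I J : C) (f : J ~> I) (X : slice I) (A : slice J)
  (u : sdom A ~> sdom X) (e : smap X ∘ u = f ∘ smap A) :
  pb1 L (smap X) f ∘ sfun (slice_gap e) = u.
Proof. exact: (gap1 (pb_pullback L (smap X) f) e). Qed.

Lemma slice_pb_heq (I J : C) (f f' : J ~> I) (X : slice I) (A : slice J)
  (h : A ~> slice_pb f X) (k : A ~> slice_pb f' X) : f = f' ->
  pb1 L (smap X) f ∘ sfun h = pb1 L (smap X) f' ∘ sfun k -> heq h k.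
Proof.
move=> e; case: _ / e k => k e; apply: eq_heq; apply: sliceHom_ext.
apply: (pullback_jointly_monic (pb_pullback L (smap X) f) e).
by rewrite (sfun_comm h) (sfun_comm k).
Qed.

Lemma slice_pb_eq (I J : C) (f : J ~> I) (X : slice I) (A : slice J)
  (h k : A ~> slice_pb f X) :
  pb1 L (smap X) f ∘ sfun h = pb1 L (smap X) f ∘ sfun k -> h = k.
Proof. by move=> e; apply: heq_eq; apply: slice_pb_heq. Qed.

Lemma slice_pb_map_subproof (I J : C) (f : J ~> I) (X Y : slice I) (h : X ~> Y) :
  smap Y ∘ (sfun h ∘ pb1 L (smap X) f) = f ∘ smap (slice_pb f X).
Proof.
by rewrite comp_assoc (sfun_comm h); case: (pb_pullback L (smap X) f).
Qed.

Definition slice_map (I J : C) (f : J ~> I) (X Y : slice I) (h : X ~> Y) :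
    slice_pb f X ~> slice_pb f Y :=
  @slice_gap I J f Y (slice_pb f X) _ (slice_pb_map_subproof f h).

Lemma slice_map1 (I J : C) (f : J ~> I) (X Y : slice I) (h : X ~> Y) :
  pb1 L (smap Y) f ∘ sfun (slice_map f h) = sfun h ∘ pb1 L (smap X) f.
Proof. exact: (slice_gap1 (A := slice_pb f X)). Qed.

Program Definition slice_reindex (I J : C) (f : J ~> I) :
    Functor (slice I) (slice J) :=
  {| fob := slice_pb f;
     fmap := slice_map f |}.
Next Obligation.
by move=> I J f X; apply: slice_pb_eq; rewrite slice_map1 /= comp_idl comp_idr.
Qed.
Next Obligation.
move=> I J f X Y Z g h; apply: slice_pb_eq; rewrite slice_map1 /=.
by rewrite comp_assoc slice_map1 -!comp_assoc slice_map1.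
Qed.

Lemma slice_id_subproof (I : C) (X : slice I) :
  smap X ∘ idm (sdom X) = idm I ∘ smap X.
Proof. by rewrite comp_idl comp_idr. Qed.

Definition slice_unit (I : C) (X : slice I) : X ~> slice_pb (idm I) X :=
  slice_gap (slice_id_subproof X).

Lemma slice_unit1 (I : C) (X : slice I) :
  pb1 L (smap X) (idm I) ∘ sfun (slice_unit X) = idm (sdom X).
Proof. exact: slice_gap1. Qed.

Program Definition slice_id (I : C) :
    NatIso (idF (slice I)) (slice_reindex (idm I)) :=
  {| ni := {| nt := @slice_unit I |} |}.
Next Obligation.
move=> I X Y f; apply: slice_pb_eq => /=.
rewrite comp_assoc slice_unit1.
rewrite comp_assoc slice_map1 -comp_assoc.
by rewrite slice_unit1 comp_idl comp_idr.
Qed.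
Next Obligation.
move=> I X; apply: (@slice_iso _ _ X (slice_pb (idm I) X) (slice_unit X)
  (pb1 L (smap X) (idm I))) => /=.
  exact: slice_unit1.
apply: (pullback_jointly_monic (pb_pullback L (smap X) (idm I))).
  by rewrite comp_assoc (gap1 (pb_pullback L (smap X) (idm I))) comp_idl comp_idr.
rewrite comp_assoc (gap2 (pb_pullback L (smap X) (idm I))) comp_idr.
by case: (pb_pullback L (smap X) (idm I)) => -> _; rewrite comp_idl.
Qed.

Lemma slice_comp_subproof (I J K : C) (f : J ~> I) (g : K ~> J) (X : slice I) :
  smap X ∘ (pb1 L (smap X) f ∘ pb1 L (smap (slice_pb f X)) g) =
  (f ∘ g) ∘ smap (slice_pb g (slice_pb f X)).
Proof.
rewrite comp_assoc (pb_pullback L (smap X) f).1 -!comp_assoc.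
by rewrite (pb_pullback L (smap (slice_pb f X)) g).1.
Qed.

Definition slice_mult (I J K : C) (f : J ~> I) (g : K ~> J) (X : slice I) :
    slice_pb g (slice_pb f X) ~> slice_pb (f ∘ g) X :=
  @slice_gap I K (f ∘ g) X (slice_pb g (slice_pb f X)) _
    (slice_comp_subproof f g X).

Lemma slice_mult1 (I J K : C) (f : J ~> I) (g : K ~> J) (X : slice I) :
  pb1 L (smap X) (f ∘ g) ∘ sfun (slice_mult f g X) =
  pb1 L (smap X) f ∘ pb1 L (smap (slice_pb f X)) g.
Proof. exact: (slice_gap1 (A := slice_pb g (slice_pb f X))). Qed.

Program Definition slice_comp (I J K : C) (f : J ~> I) (g : K ~> J) :
    NatIso (slice_reindex g ∘F slice_reindex f) (slice_reindex (f ∘ g)) :=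
  {| ni := {| nt := slice_mult f g |} |}.
Next Obligation.
move=> I J K f g X Y h; apply: slice_pb_eq => /=.
rewrite comp_assoc slice_mult1.
rewrite comp_assoc slice_map1.
rewrite -!comp_assoc slice_mult1.
rewrite (slice_map1 g (slice_map f h)).
by rewrite comp_assoc slice_map1 comp_assoc.
Qed.
Next Obligation.
move=> I J K f g X.
set Pf := pb_pullback L (smap X) f.
set Pg := pb_pullback L (smap (slice_pb f X)) g.
set Pfg := pb_pullback L (smap X) (f ∘ g).
have e1 : smap X ∘ pb1 L (smap X) (f ∘ g) = f ∘ (g ∘ pb2 L (smap X) (f ∘ g)).
  by rewrite Pfg.1 comp_assoc.
have e2 : smap (slice_pb f X) ∘ gap Pf e1 = g ∘ pb2 L (smap X) (f ∘ g).
  exact: (gap2 Pf e1).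
apply: (@slice_iso _ _ (slice_pb g (slice_pb f X)) (slice_pb (f ∘ g) X)
  (slice_mult f g X) (gap Pg e2)) => /=.
  apply: (pullback_jointly_monic Pg); last first.
    by rewrite comp_assoc gap2 comp_idr (gap2 Pfg).
  rewrite comp_assoc gap1 comp_idr; apply: (pullback_jointly_monic Pf).
    by rewrite comp_assoc gap1 (gap1 Pfg).
  by rewrite comp_assoc gap2 -comp_assoc (gap2 Pfg) -Pg.1.
apply: (pullback_jointly_monic Pfg).
  by rewrite comp_assoc (gap1 Pfg) -comp_assoc gap1 gap1 comp_idr.
by rewrite comp_assoc (gap2 Pfg) gap2 comp_idr.
Qed.

(* [slice (-)], with reindexing along the chosen pullbacks. *)
Program Definition self_indexing : IndexedCat C :=
  {| icat := @slice C; reindex := slice_reindex;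
     iid := slice_id; icomp := slice_comp |}.
Next Obligation.
move=> I J f X; apply: slice_pb_heq; rewrite ?comp_idl //=.
rewrite comp_assoc slice_mult1 comp_idr.
rewrite -comp_assoc (slice_map1 f (slice_unit X)).
by rewrite comp_assoc slice_unit1 comp_idl.
Qed.
Next Obligation.
move=> I J f X; apply: slice_pb_heq; rewrite ?comp_idr //=.
rewrite comp_assoc slice_mult1.
by rewrite -comp_assoc (slice_unit1 (slice_pb f X)).
Qed.
Next Obligation.
move=> I J K M f g h X; apply: slice_pb_heq; first by rewrite comp_assoc.
transitivity (pb1 L (smap X) f ∘ pb1 L (smap (slice_pb f X)) g
    ∘ pb1 L (smap (slice_pb g (slice_pb f X))) h).
  apply: etrans (comp_assoc _ _ _) _.
  apply: etrans (congr1 (fun k => k ∘ _) (slice_mult1 (f ∘ g) h X)) _.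
  apply: etrans (esym (comp_assoc _ _ _)) _.
  apply: etrans (congr1 (comp _) (slice_map1 h (slice_mult f g X))) _.
  by rewrite comp_assoc slice_mult1.
apply: esym; apply: etrans (comp_assoc _ _ _) _.
apply: etrans (congr1 (fun k => k ∘ _) (slice_mult1 f (g ∘ h) X)) _.
by rewrite -!comp_assoc -(slice_mult1 g h (slice_pb f X)).
Qed.
End SelfIndexing.

Definition dense_logical_subtopos (C : Category) (D : CartCat)
    (i : Functor C D) : Prop :=
  [/\ logical_subtopos i,
      forall X : D, is_sheaf i X
    & is_stack i (self_indexing (cc_lim D))].

Record NDiagram : Type := {
  nd :> nat -> CartCat;
  tr : forall m n : nat, (m <= n)%N -> Functor (nd m) (nd n);
  tr_id : forall (n : nat) (h : (n <= n)%N), tr h = idF (nd n);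
  tr_comp : forall (m n p : nat) (h : (m <= n)%N) (k : (n <= p)%N)
      (l : (m <= p)%N), tr l = tr k ∘F tr h }.

Arguments tr n {m n0} _ : rename.

(* [Topos] is the full sub-2-category, on toposes, of the 2-category of
   [CartCat]s, so a functor from the poset of natural numbers to [Topos] is an
   [NDiagram] satisfying the following. *)
Definition topos_valued (E : NDiagram) : Prop :=
  (forall n : nat, is_topos (E n)) /\
  (forall (m n : nat) (h : (m <= n)%N), cartesian_functor (tr E h)).

Record NTransf (E F : NDiagram) : Type := {
  nf :> forall n : nat, Functor (E n) (F n);
  nf_cart : forall n : nat, cartesian_functor (nf n);
  nf_nat : forall (m n : nat) (h : (m <= n)%N),
    nf n ∘F tr E h = tr F h ∘F nf m }.

Record NModif (E F : NDiagram) (S T : NTransf E F) : Type := {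
  nm :> forall n : nat, NatTrans (S n) (T n);
  nm_compat : forall (m n : nat) (h : (m <= n)%N) (A : E m),
    heq (nm n (tr E h A)) (fmap (tr F h) (nm m A)) }.

Lemma compF_assoc (A B C D : Category) (H : Functor C D) (G : Functor B C)
  (F : Functor A B) : H ∘F (G ∘F F) = H ∘F G ∘F F.
Proof. exact: functor_ext. Qed.

Program Definition nf_id (E : NDiagram) : NTransf E E :=
  {| nf := fun n => idF (E n) |}.
Next Obligation. by []. Qed.
Next Obligation. by move=> E m n h; apply: functor_ext. Qed.

Program Definition nf_comp (E F G : NDiagram) (T : NTransf F G) (S : NTransf E F) :
    NTransf E G :=
  {| nf := fun n => T n ∘F S n |}.
Next Obligation.
move=> E F G T S n; have [t1 t2] := nf_cart T n; have [s1 s2] := nf_cart S n.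
split=> [A /s1/t1 //|A B X f g P p1 p2 /s2/t2 //].
Qed.
Next Obligation.
move=> E F G T S m n h.
by rewrite -compF_assoc nf_nat compF_assoc nf_nat compF_assoc.
Qed.

Definition stratified_topos (E : NDiagram) : Prop :=
  [/\ topos_valued E,
      forall (m n : nat) (h : (m <= n)%N), dense_logical_subtopos (tr E h)
    & forall (m n : nat) (h : (m <= n)%N), (m < n)%N ->
        exists (X Y : E n) (p : X ~> Y), generic_locally_small (tr E h) p].

Definition stratified_cartesian (E F : NDiagram) (T : NTransf E F) : Prop :=
  forall (m n : nat) (h : (m <= n)%N),
    morphism_of_sites (tr E h) (tr F h) (T n).

Record Comonad (C : Category) : Type := {
  cm :> Functor C C;
  counit : NatTrans cm (idF C);
  comult : NatTrans cm (cm ∘F cm);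
  counit_l : forall A, counit (cm A) ∘ comult A = idm (cm A);
  counit_r : forall A, fmap cm (counit A) ∘ comult A = idm (cm A);
  comult_assoc : forall A,
    comult (cm A) ∘ comult A = fmap cm (comult A) ∘ comult A }.

Arguments counit {C} _.
Arguments comult {C} _.

(* A comonad on [E] in the 2-category of diagrams: 1-cells are [NTransf],
   2-cells are [NModif]. *)
Record NComonad (E : NDiagram) : Type := {
  nc :> NTransf E E;
  ncounit : NModif nc (nf_id E);
  ncomult : NModif nc (nf_comp nc nc);
  ncounit_l : forall n (A : E n), ncounit n (nc n A) ∘ ncomult n A = idm (nc n A);
  ncounit_r : forall n (A : E n),
    fmap (nc n) (ncounit n A) ∘ ncomult n A = idm (nc n A);
  ncomult_assoc : forall n (A : E n),
    ncomult n (nc n A) ∘ ncomult n A = fmap (nc n) (ncomult n A) ∘ ncomult n A }.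

Definition level (E : NDiagram) (B : NComonad E) (n : nat) : Comonad (E n) :=
  {| cm := B n; counit := ncounit B n; comult := ncomult B n;
     counit_l := @ncounit_l E B n; counit_r := @ncounit_r E B n;
     comult_assoc := @ncomult_assoc E B n |}.

Record CoalgOb (C : Category) (T : Comonad C) : Type := {
  carrier : C;
  coact : carrier ~> T carrier;
  coact_counit : counit T carrier ∘ coact = idm carrier;
  coact_comult : comult T carrier ∘ coact = fmap T coact ∘ coact }.

Record CoalgHom (C : Category) (T : Comonad C) (A B : CoalgOb T) : Type := {
  cfun :> carrier A ~> carrier B;
  cfun_comm : coact B ∘ cfun = fmap T cfun ∘ coact A }.

Lemma coalgHom_ext (C : Category) (T : Comonad C) (A B : CoalgOb T)
  (f g : CoalgHom A B) : cfun f = cfun g -> f = g.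
Proof.
case: f g => [f hf] [g hg] /= e; case: _ / e hg => hg.
by rewrite (Prop_irrelevance hf hg).
Qed.

Program Definition Coalg (C : Category) (T : Comonad C) : Category :=
  {| Ob := CoalgOb T; Hom := @CoalgHom C T;
     idm := fun A => {| cfun := idm (carrier A) |};
     comp := fun A B X g f => {| cfun := cfun g ∘ cfun f |} |}.
Next Obligation. by move=> *; rewrite fmap_id comp_idl comp_idr. Qed.
Next Obligation.
move=> C T A B X g f.
by rewrite comp_assoc cfun_comm -comp_assoc cfun_comm comp_assoc fmap_comp.
Qed.
Next Obligation. by move=> *; apply: coalgHom_ext; rewrite /= comp_idl. Qed.
Next Obligation. by move=> *; apply: coalgHom_ext; rewrite /= comp_idr. Qed.
Next Obligation. by move=> *; apply: coalgHom_ext; rewrite /= comp_assoc. Qed.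

Definition forget (C : Category) (T : Comonad C) : Functor (Coalg T) C :=
  {| fob := @carrier C T : Coalg T -> C; fmap := fun A B f => cfun f;
     fmap_id := fun A => erefl; fmap_comp := fun A B X g f => erefl |}.

Lemma coalg_ob_eq (C : Category) (T : Comonad C) (A B : Coalg T) :
  carrier A = carrier B -> heq (coact A) (coact B) -> A = B.
Proof.
case: A B => [A a ha ka] [B b hb kb] /= e.
case: _ / e b hb kb => b hb kb /heq_eq e.
case: _ / e hb kb => hb kb.
by rewrite (Prop_irrelevance ha hb) (Prop_irrelevance ka kb).
Qed.

Lemma coalg_heq (C : Category) (T : Comonad C) (A B A' B' : Coalg T)
  (f : A ~> B) (g : A' ~> B') :
  A = A' -> B = B' -> heq (cfun f) (cfun g) -> heq f g.
Proof.
move=> eA eB; case: _ / eA g => g; case: _ / eB g => g /heq_eq e.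
exact/eq_heq/coalgHom_ext.
Qed.

Section CoalgLimits.
Context (C : Category) (L : FinLimits C) (T : Comonad C).
Context (hT : cartesian_functor T).

Definition coalg_top : Coalg T.
Proof.
refine {| carrier := top L;
          coact := to_terminal (hT.1 _ (top_terminal L)) (top L) |}.
- exact: (to_terminal_uniq (top_terminal L)).
- exact: (to_terminal_uniq (hT.1 _ (hT.1 _ (top_terminal L)))).
Defined.

Lemma coalg_top_terminal : is_terminal coalg_top.
Proof.
move=> A.
have h : coact coalg_top ∘ to_top L (carrier A) =
         fmap T (to_top L (carrier A)) ∘ coact A.
  exact: (to_terminal_uniq (hT.1 _ (top_terminal L))).
exists {| cfun := to_top L (carrier A) : carrier A ~> carrier coalg_top;
          cfun_comm := h |}.
by move=> g; apply: coalgHom_ext; apply: (to_terminal_uniq (top_terminal L)).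
Qed.

Section Pb.
Context (A B X : Coalg T) (f : A ~> X) (g : B ~> X).
Let p1 := pb1 L (cfun f) (cfun g).
Let p2 := pb2 L (cfun f) (cfun g).
Let isP : is_pullback (cfun f) (cfun g) p1 p2 := pb_pullback L _ _.
Let isTP := hT.2 _ _ _ _ _ _ _ _ isP.
Let isTTP := hT.2 _ _ _ _ _ _ _ _ isTP.

Lemma coalg_pb_subproof :
  fmap T (cfun f) ∘ (coact A ∘ p1) = fmap T (cfun g) ∘ (coact B ∘ p2).
Proof. by rewrite !comp_assoc -!cfun_comm -!comp_assoc isP.1. Qed.

Let s := gap isTP coalg_pb_subproof.
Let s1 : fmap T p1 ∘ s = coact A ∘ p1 := gap1 isTP coalg_pb_subproof.
Let s2 : fmap T p2 ∘ s = coact B ∘ p2 := gap2 isTP coalg_pb_subproof.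

Definition coalg_pb : Coalg T.
Proof.
refine {| carrier := pb L (cfun f) (cfun g); coact := s |}.
- apply: (pullback_jointly_monic isP); rewrite comp_assoc comp_idr.
    rewrite -[p1 ∘ counit T _](nt_nat (counit T) p1) -comp_assoc s1.
    by rewrite comp_assoc coact_counit comp_idl.
  rewrite -[p2 ∘ counit T _](nt_nat (counit T) p2) -comp_assoc s2.
  by rewrite comp_assoc coact_counit comp_idl.
- apply: (pullback_jointly_monic isTTP); rewrite !comp_assoc.
    rewrite -[fmap T (fmap T p1) ∘ comult T _](nt_nat (comult T) p1).
    rewrite -fmap_comp s1 fmap_comp -!comp_assoc s1.
    by rewrite !comp_assoc coact_comult.
  rewrite -[fmap T (fmap T p2) ∘ comult T _](nt_nat (comult T) p2).
  rewrite -fmap_comp s2 fmap_comp -!comp_assoc s2.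
  by rewrite !comp_assoc coact_comult.
Defined.

Definition coalg_pb1 : coalg_pb ~> A :=
  {| cfun := p1 : carrier coalg_pb ~> carrier A; cfun_comm := esym s1 |}.

Definition coalg_pb2 : coalg_pb ~> B :=
  {| cfun := p2 : carrier coalg_pb ~> carrier B; cfun_comm := esym s2 |}.

Lemma coalg_pb_pullback : is_pullback f g coalg_pb1 coalg_pb2.
Proof.
split; first by apply: coalgHom_ext; exact: isP.1.
move=> Q q1 q2 e.
have e' : cfun f ∘ cfun q1 = cfun g ∘ cfun q2 := congr1 (@cfun _ _ _ _) e.
have hh : coact coalg_pb ∘ gap isP e' = fmap T (gap isP e') ∘ coact Q.
  apply: (pullback_jointly_monic isTP); rewrite !comp_assoc -fmap_comp.
    by rewrite gap1 s1 -comp_assoc gap1 cfun_comm.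
  by rewrite gap2 s2 -comp_assoc gap2 cfun_comm.
exists {| cfun := gap isP e' : carrier Q ~> carrier coalg_pb; cfun_comm := hh |}.
split.
  by split; apply: coalgHom_ext; [exact: gap1|exact: gap2].
move=> k [k1 k2]; apply: coalgHom_ext.
apply: (pullback_jointly_monic isP).
  by rewrite gap1 -k1.
by rewrite gap2 -k2.
Qed.
End Pb.

Definition coalg_lim : FinLimits (Coalg T) :=
  {| top := coalg_top; top_terminal := coalg_top_terminal;
     pb := coalg_pb; pb1 := coalg_pb1; pb2 := coalg_pb2;
     pb_pullback := coalg_pb_pullback |}.

Lemma forget_strict_top : forget T (top coalg_lim) = top L.
Proof. by []. Qed.

Lemma forget_strict_pb (A B X : Coalg T) (f : A ~> X) (g : B ~> X) :
  [/\ forget T (pb coalg_lim f g) = pb L (fmap (forget T) f) (fmap (forget T) g),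
      fmap (forget T) (pb1 coalg_lim f g) =
        pb1 L (fmap (forget T) f) (fmap (forget T) g)
    & fmap (forget T) (pb2 coalg_lim f g) =
        pb2 L (fmap (forget T) f) (fmap (forget T) g)].
Proof. by []. Qed.
End CoalgLimits.

Section CoalgDiagram.
Context (E : NDiagram) (B : NComonad E).

Lemma comm_ob (m n : nat) (h : (m <= n)%N) (A : E m) :
  tr E h (B m A) = B n (tr E h A).
Proof. exact: esym (congr1 (fun F : Functor _ _ => F A) (nf_nat B h)). Qed.

Lemma comm_hom (m n : nat) (h : (m <= n)%N) (A A' : E m) (f : A ~> A') :
  heq (fmap (tr E h) (fmap (B m) f)) (fmap (B n) (fmap (tr E h) f)).
Proof. exact: heq_sym (heq_functor f (nf_nat B h)). Qed.

(* [(A, a)] is sent to [(i A, i a)]; the codomain [i (B m A)] of [i a] is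
   the object [B n (i A)] by strict naturality of [B]. *)
Definition coalg_tr_ob (m n : nat) (h : (m <= n)%N) (A : Coalg (level B m)) :
  Coalg (level B n).
Proof.
refine {| carrier := tr E h (carrier A);
          coact := (idto (comm_ob h (carrier A)) ∘ fmap (tr E h) (coact A))
            : tr E h (carrier A) ~> level B n (tr E h (carrier A)) |}.
- apply: heq_eq.
  apply: heq_trans (heq_comp (esym (comm_ob h (carrier A)))
    (nm_compat (ncounit B) h (carrier A)) (heq_idtol _ _)) _.
  rewrite -fmap_comp; apply: eq_heq.
  by rewrite [_ ∘ _](coact_counit A) fmap_id.
- apply: heq_eq.
  apply: heq_trans (heq_comp (esym (comm_ob h (carrier A)))
    (nm_compat (ncomult B) h (carrier A)) (heq_idtol _ _)) _.
  rewrite -fmap_comp [_ ∘ coact A](coact_comult A) fmap_comp.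
  apply: heq_comp; first exact: comm_ob.
    apply: heq_trans (comm_hom h (coact A)) _.
    exact: heq_fmap (heq_sym (heq_idtol _ _)).
  exact: heq_sym (heq_idtol _ _).
Defined.

Definition coalg_tr_hom (m n : nat) (h : (m <= n)%N) (A A' : Coalg (level B m))
    (f : A ~> A') : coalg_tr_ob h A ~> coalg_tr_ob h A'.
Proof.
refine {| cfun := fmap (tr E h) (cfun f)
    : carrier (coalg_tr_ob h A) ~> carrier (coalg_tr_ob h A') |}.
apply: heq_eq; rewrite -[coact _ ∘ _]comp_assoc -fmap_comp cfun_comm.
apply: heq_trans (heq_idtol _ _) _; rewrite fmap_comp.
apply: heq_comp; first exact: comm_ob.
  exact: comm_hom.
exact: heq_sym (heq_idtol _ _).
Defined.

Program Definition coalg_tr (m n : nat) (h : (m <= n)%N) :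
    Functor (Coalg (level B m)) (Coalg (level B n)) :=
  {| fob := coalg_tr_ob h; fmap := @coalg_tr_hom m n h |}.
Next Obligation. by move=> *; apply: coalgHom_ext; rewrite /= fmap_id. Qed.
Next Obligation. by move=> *; apply: coalgHom_ext; rewrite /= fmap_comp. Qed.

Program Definition coalg_diagram : NDiagram :=
  {| nd := fun n => {| cc_cat := Coalg (level B n);
                       cc_lim := coalg_lim (cc_lim (E n)) (T := level B n)
                                   (nf_cart B n) |};
     tr := coalg_tr |}.
Next Obligation.
move=> n h; have e := tr_id E h.
have eob A : coalg_tr_ob h A = A.
  apply: coalg_ob_eq => /=; first by rewrite e.
  apply: heq_trans (heq_idtol _ _) _; exact: heq_functor e.
apply: functor_ext => // A A' f.
by apply: coalg_heq => //=; exact: heq_functor e.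
Qed.
Next Obligation.
move=> m n p h k l; have e := tr_comp E h k l.
have eob A : coalg_tr_ob l A = coalg_tr_ob k (coalg_tr_ob h A).
  apply: coalg_ob_eq => /=; first by rewrite e.
  apply: heq_trans (heq_idtol _ _) _.
  apply: heq_trans (heq_functor _ e) _ => /=.
  apply: heq_trans (heq_sym (heq_idtol _ _)).
  exact: heq_fmap (heq_sym (heq_idtol _ _)).
apply: functor_ext => // A A' f.
by apply: coalg_heq => //=; exact: heq_functor e.
Qed.
End CoalgDiagram.

(* Main.v *)
From mathcomp Require Import all_boot.
From mathcomp Require Import boolp.
Require Import Defs.

Set Implicit Arguments.
Unset Strict Implicit.
Unset Printing Implicit Defensive.
Local Open Scope cat_scope.
#[local] Obligation Tactic := idtac.

(** Write [i] for the inclusion of level [m] in level [n], [U] for the functors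
    forgetting coalgebra structures and [j] for the inclusion of the coalgebras
    of level [m] among those of level [n].

    Each level is a topos by the classical construction: finite limits of
    coalgebras are computed on carriers, exponentials and the subobject
    classifier are equalizers of two maps between cofree coalgebras
    ([coalg_topos]).  All of these are obtained from the topos structure of the
    base by finite limits, exponentials, [Omega] and the comonad, operations
    under which the image of [i] is closed; and a coalgebra belongs to the image
    of [j] as soon as its carrier belongs to the image of [i]
    ([coalg_tr_image]).  Hence [j] is the inclusion of a logical subtopos.

    Everything else rests on one covering property ([coalg_cover]): every map
    from a small object to the carrier of a coalgebra [X] factors through the
    carrier of a small coalgebra over [X].  Indeed, composing [f : i Y ~> U X]
    with the coaction gives a map to [T X], which the condition of morphism of
    sites factors through [T g] for some [g : i A ~> X]; the pullback of the
    cofree coalgebra on [A] along the coaction of [X] is a subcoalgebra of it,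
    hence small, since subobjects of small objects are classified by small
    maps.  For the same reason, pullbacks of small coalgebras over an arbitrary
    coalgebra are small ([coalg_pullback_small]).

    Density.  Both density conditions are moved from the base to coalgebras.
    That objects are sheaves says that a map out of [X] is a compatible family
    of maps out of the small objects over [X], and by the covering property
    those may be taken to be small coalgebras ([coalg_sheaf]).  For the stack
    condition, pseudonatural families are replaced by descent data, that is,
    functorial families of cartesian squares over the small objects above [I],
    together with the requirement that each of them come from an object over
    [I].  Given that all objects are sheaves, this requirement is equivalent to
    the stack condition ([stack_effective], [effective_stack]).  A descent
    datum of coalgebras is extended to all small objects over the carrier of [I]
    by pulling back along covering coalgebras, and is glued in the base
    ([underlying_glueing]); the coactions of its members then glue to a coaction
    on the resulting object ([coalg_effective]).

    Generic map.  A map of coalgebras is locally small exactly when its carrier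
    is ([locally_small_carrier]).  Let [p] be the generic map of the base.  If
    the carrier of [q : X ~> Y] is a pullback of [p] along [f], then the
    coalgebra maps corresponding to [f] and to its companion exhibit [X] as a
    subobject of the pullback of the cofree map on [p].  So [q] is a pullback of
    the universal family of subobjects of fibres of that cofree map, which
    exists in any topos ([relative_power]) and is again locally small, because
    the comonad preserves locally small maps ([box_locally_small]). *)

(** * Isomorphisms, pullbacks and equivalences *)

Lemma iso_idm (C : Category) (A : C) : is_iso (idm A).
Proof. by exists (idm A); rewrite comp_idl. Qed.

Lemma iso_comp (C : Category) (A B X : C) (g : B ~> X) (f : A ~> B) :
  is_iso g -> is_iso f -> is_iso (g ∘ f).
Proof.
move=> [g' [g1 g2]] [f' [f1 f2]]; exists (f' ∘ g'); split.
  by rewrite -comp_assoc (comp_assoc g') g1 comp_idl f1.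
by rewrite -comp_assoc (comp_assoc f) f2 comp_idl g2.
Qed.

Lemma iso_fmap (C D : Category) (F : Functor C D) (A B : C) (f : A ~> B) :
  is_iso f -> is_iso (fmap F f).
Proof.
by move=> [g [e1 e2]]; exists (fmap F g); rewrite -!fmap_comp e1 e2 !fmap_id.
Qed.

Definition iso_inv (C : Category) (A B : C) (f : A ~> B) (hf : is_iso f) :
  B ~> A := proj1_sig (cid hf).

Lemma iso_invl (C : Category) (A B : C) (f : A ~> B) (hf : is_iso f) :
  iso_inv hf ∘ f = idm A.
Proof. by rewrite /iso_inv; case: cid => g []. Qed.

Lemma iso_invr (C : Category) (A B : C) (f : A ~> B) (hf : is_iso f) :
  f ∘ iso_inv hf = idm B.
Proof. by rewrite /iso_inv; case: cid => g []. Qed.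

Lemma iso_iso_inv (C : Category) (A B : C) (f : A ~> B) (hf : is_iso f) :
  is_iso (iso_inv hf).
Proof. by exists f; rewrite iso_invl iso_invr. Qed.

Lemma iso_epi (C : Category) (A B X : C) (f : A ~> B) (g h : B ~> X) :
  is_iso f -> g ∘ f = h ∘ f -> g = h.
Proof.
by move=> [k [_ e]] eq; rewrite -(comp_idr g) -(comp_idr h) -e !comp_assoc eq.
Qed.

Section Pullbacks.
Context (C : Category).

Lemma pb_sym (A B X P : C) (f : A ~> X) (g : B ~> X) (p1 : P ~> A)
    (p2 : P ~> B) :
  is_pullback f g p1 p2 -> is_pullback g f p2 p1.
Proof.
move=> hP; split; first exact: esym hP.1.
move=> Q q1 q2 e; exists (gap hP (esym e)); split; first by rewrite gap1 gap2.
by move=> k [k1 k2]; apply: (pullback_jointly_monic hP); rewrite ?gap1 ?gap2.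
Qed.

Lemma pb_intro (A B X P : C) (f : A ~> X) (g : B ~> X) (p1 : P ~> A)
    (p2 : P ~> B) :
  f ∘ p1 = g ∘ p2 ->
  (forall (Q : C) (q1 : Q ~> A) (q2 : Q ~> B), f ∘ q1 = g ∘ q2 ->
    exists h : Q ~> P, p1 ∘ h = q1 /\ p2 ∘ h = q2) ->
  (forall (Q : C) (h k : Q ~> P), p1 ∘ h = p1 ∘ k -> p2 ∘ h = p2 ∘ k -> h = k) ->
  is_pullback f g p1 p2.
Proof.
move=> e ex un; split=> // Q q1 q2 /ex [h [h1 h2]]; exists h; split=> // k [k1 k2].
by apply: un; rewrite ?h1 ?h2.
Qed.

Lemma pb_paste (A A' B X P Q : C) (f : A ~> X) (g : B ~> X) (p1 : P ~> A)
    (p2 : P ~> B) (a : A' ~> A) (q1 : Q ~> A') (q2 : Q ~> P) :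
  is_pullback f g p1 p2 -> is_pullback a p1 q1 q2 ->
  is_pullback (f ∘ a) g q1 (p2 ∘ q2).
Proof.
move=> hP hQ; apply: pb_intro.
- by rewrite -comp_assoc hQ.1 !comp_assoc hP.1.
- move=> Z z1 z2 e; rewrite -comp_assoc in e.
  have e' : a ∘ z1 = p1 ∘ gap hP e by rewrite gap1.
  by exists (gap hQ e'); rewrite -comp_assoc gap1 gap2 gap2.
- move=> Z h k e1 e2; apply: (pullback_jointly_monic hQ) => //.
  apply: (pullback_jointly_monic hP); last by rewrite !comp_assoc.
  by rewrite !comp_assoc -hQ.1 -!comp_assoc e1.
Qed.

Lemma pb_cancel (A A' B X P Q : C) (f : A ~> X) (g : B ~> X) (p1 : P ~> A)
    (p2 : P ~> B) (a : A' ~> A) (q1 : Q ~> A') (q2 : Q ~> P) :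
  is_pullback f g p1 p2 -> is_pullback (f ∘ a) g q1 (p2 ∘ q2) ->
  a ∘ q1 = p1 ∘ q2 -> is_pullback a p1 q1 q2.
Proof.
move=> hP hQ eq; apply: pb_intro => //.
- move=> Z z1 z2 e.
  have e' : (f ∘ a) ∘ z1 = g ∘ (p2 ∘ z2).
    by rewrite -comp_assoc e !comp_assoc hP.1.
  exists (gap hQ e'); rewrite gap1; split=> //.
  apply: (pullback_jointly_monic hP).
    by rewrite comp_assoc -eq -comp_assoc gap1.
  by rewrite comp_assoc gap2.
- move=> Z h k e1 e2; apply: (pullback_jointly_monic hQ) => //.
  by rewrite -!comp_assoc e2.
Qed.

Lemma pb_precomp_iso (A B X P Q : C) (f : A ~> X) (g : B ~> X) (p1 : P ~> A)
    (p2 : P ~> B) (k : Q ~> P) :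
  is_pullback f g p1 p2 -> is_iso k -> is_pullback f g (p1 ∘ k) (p2 ∘ k).
Proof.
move=> hP [l [lk kl]]; apply: pb_intro.
- by rewrite !comp_assoc hP.1.
- move=> Z z1 z2 e; exists (l ∘ gap hP e); rewrite -!comp_assoc.
  by rewrite !(comp_assoc k) kl comp_idl gap1 gap2.
- move=> Z h h' e1 e2.
  have : k ∘ h = k ∘ h'.
    by apply: (pullback_jointly_monic hP); rewrite !comp_assoc.
  by move/(congr1 (comp l)); rewrite !comp_assoc lk !comp_idl.
Qed.

Lemma pb_compare (A B X P Q : C) (f : A ~> X) (g : B ~> X) (p1 : P ~> A)
    (p2 : P ~> B) (q1 : Q ~> A) (q2 : Q ~> B) :
  is_pullback f g p1 p2 -> is_pullback f g q1 q2 ->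
  exists k : Q ~> P, [/\ is_iso k, p1 ∘ k = q1 & p2 ∘ k = q2].
Proof.
move=> hP hQ; exists (gap hP hQ.1); rewrite gap1 gap2; split=> //.
exists (gap hQ hP.1); split.
  by apply: (pullback_jointly_monic hQ); rewrite comp_assoc ?gap1 ?gap2 comp_idr
    ?gap1 ?gap2.
by apply: (pullback_jointly_monic hP); rewrite comp_assoc ?gap1 ?gap2 comp_idr
    ?gap1 ?gap2.
Qed.

Lemma pb_iso_of (A B X P Q : C) (f : A ~> X) (g : B ~> X) (p1 : P ~> A)
    (p2 : P ~> B) (q1 : Q ~> A) (q2 : Q ~> B) (k : Q ~> P) :
  is_pullback f g p1 p2 -> is_pullback f g q1 q2 ->
  p1 ∘ k = q1 -> p2 ∘ k = q2 -> is_iso k.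
Proof.
move=> hP hQ e1 e2; have [k' [hk e1' e2']] := pb_compare hP hQ.
suff -> : k = k' by [].
by apply: (pullback_jointly_monic hP); rewrite ?e1 ?e2.
Qed.

Lemma pb_monic (A B X P : C) (f : A ~> X) (g : B ~> X) (p1 : P ~> A)
    (p2 : P ~> B) :
  is_pullback f g p1 p2 -> monic f -> monic p2.
Proof.
move=> hP hf Z h k e; apply: (pullback_jointly_monic hP) => //.
by apply: hf; rewrite !comp_assoc hP.1 -!comp_assoc e.
Qed.

Lemma terminal_iso (S T : C) (k : S ~> T) :
  is_terminal S -> is_terminal T -> is_iso k.
Proof.
move=> hS hT; exists (to_terminal hS T).
by split; [exact: (to_terminal_uniq hS)|exact: (to_terminal_uniq hT)].
Qed.

(** Being monic is a pullback condition, hence preserved by cartesian functors. *)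
Lemma monic_kernel_pair (A B : C) (m : A ~> B) :
  monic m <-> is_pullback m m (idm A) (idm A).
Proof.
split=> [hm|hP Z h k e]; last by rewrite -(gap1 hP e) -[RHS](gap2 hP e).
apply: pb_intro => // [Q q1 q2 /hm -> | Q h k].
  by exists q2; rewrite comp_idl.
by rewrite !comp_idl.
Qed.

Definition is_product (A B P : C) (p1 : P ~> A) (p2 : P ~> B) : Prop :=
  forall (Q : C) (q1 : Q ~> A) (q2 : Q ~> B),
    exists! h : Q ~> P, p1 ∘ h = q1 /\ p2 ∘ h = q2.

Lemma pb_product (T A B P : C) (f : A ~> T) (g : B ~> T) (p1 : P ~> A)
    (p2 : P ~> B) :
  is_terminal T -> is_pullback f g p1 p2 -> is_product p1 p2.
Proof. by move=> hT hP Q q1 q2; apply: hP.2; apply: (to_terminal_uniq hT). Qed.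

Lemma product_jointly_monic (A B P : C) (p1 : P ~> A) (p2 : P ~> B) (Q : C)
    (h k : Q ~> P) :
  is_product p1 p2 -> p1 ∘ h = p1 ∘ k -> p2 ∘ h = p2 ∘ k -> h = k.
Proof.
move=> hP e1 e2; have [u [_ uu]] := hP Q (p1 ∘ k) (p2 ∘ k).
by rewrite -(uu h) // -(uu k).
Qed.
End Pullbacks.

Section Products.
Context (C : Category) (L : FinLimits C).

Lemma cprod_product (A B : C) : is_product (cfst L A B) (csnd L A B).
Proof. exact: pb_product (top_terminal L) (pb_pullback L _ _). Qed.

Lemma cpair_fst (A B Q : C) (q1 : Q ~> A) (q2 : Q ~> B) :
  cfst L A B ∘ cpair L q1 q2 = q1.
Proof. exact: gap1. Qed.

Lemma cpair_snd (A B Q : C) (q1 : Q ~> A) (q2 : Q ~> B) :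
  csnd L A B ∘ cpair L q1 q2 = q2.
Proof. exact: gap2. Qed.

Lemma cpair_comp (A B Q R : C) (q1 : Q ~> A) (q2 : Q ~> B) (h : R ~> Q) :
  cpair L q1 q2 ∘ h = cpair L (q1 ∘ h) (q2 ∘ h).
Proof.
apply: (product_jointly_monic (@cprod_product A B)).
  by rewrite comp_assoc !cpair_fst.
by rewrite comp_assoc !cpair_snd.
Qed.

Lemma cpair_eta (A B Q : C) (h : Q ~> cprod L A B) :
  h = cpair L (cfst L A B ∘ h) (csnd L A B ∘ h).
Proof.
by apply: (product_jointly_monic (@cprod_product A B));
  rewrite ?cpair_fst ?cpair_snd.
Qed.

(** An equalizer can be written as a pullback of graphs. *)
Lemma graphs_pullback (X V P : C) (a b : X ~> V) (p1 p2 : P ~> X) :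
  is_pullback (cpair L (idm X) a) (cpair L (idm X) b) p1 p2 ->
  p1 = p2 /\ a ∘ p1 = b ∘ p1.
Proof.
move=> [e _].
have e1 := congr1 (comp (cfst L X V)) e; have e2 := congr1 (comp (csnd L X V)) e.
move: e1 e2; rewrite !comp_assoc !cpair_fst !cpair_snd !comp_idl => e1 e2.
by split; rewrite // e2 e1.
Qed.

Lemma graphs_pullback_monic (X V P : C) (a b : X ~> V) (p1 p2 : P ~> X) :
  is_pullback (cpair L (idm X) a) (cpair L (idm X) b) p1 p2 -> monic p1.
Proof.
move=> hP Z h k e; apply: (pullback_jointly_monic hP) => //.
by have [<- _] := graphs_pullback hP.
Qed.

Lemma graphs_pullback_factor (X V P Z : C) (a b : X ~> V) (p1 p2 : P ~> X)
    (f : Z ~> X) :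
  is_pullback (cpair L (idm X) a) (cpair L (idm X) b) p1 p2 ->
  a ∘ f = b ∘ f -> exists g : Z ~> P, p1 ∘ g = f.
Proof.
move=> hP e.
have e' : cpair L (idm X) a ∘ f = cpair L (idm X) b ∘ f.
  by rewrite !cpair_comp e.
by exists (gap hP e'); rewrite gap1.
Qed.

(** The carrier of a chosen product of coalgebras is a product of the carriers,
    but not the chosen one; so currying is needed along any product diagram. *)
Lemma curry_product (E : Exponentials L) (A B X P : C) (p1 : P ~> X)
    (p2 : P ~> A) (f : P ~> B) :
  is_product p1 p2 ->
  exists! g : X ~> expo E A B, ev E A B ∘ cpair L (g ∘ p1) p2 = f.
Proof.
move=> hP; have [k [[k1 k2] _]] := hP _ (cfst L X A) (csnd L X A).
have kp : k ∘ cpair L p1 p2 = idm P.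
  by apply: (product_jointly_monic hP); rewrite comp_assoc ?k1 ?k2 ?cpair_fst
    ?cpair_snd comp_idr.
have pk : cpair L p1 p2 ∘ k = idm _.
  rewrite cpair_comp k1 k2 [RHS]cpair_eta; congr cpair; by rewrite comp_idr.
have pm (g : X ~> expo E A B) : prod_map L A g ∘ cpair L p1 p2 =
    cpair L (g ∘ p1) p2.
  by rewrite /prod_map cpair_comp -comp_assoc cpair_fst cpair_snd.
have [g [eg ug]] := exp_universal E (f ∘ k); exists g; split.
  by rewrite -pm comp_assoc eg -comp_assoc kp comp_idr.
move=> g' eg'; apply: ug; rewrite -eg' -pm -!comp_assoc pk.
by rewrite comp_idr.
Qed.
End Products.

Section Equivalence.
Context (C D : Category) (F : Functor C D).

Lemma equivalence_surj : is_equivalence F ->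
  forall Y : D, exists (X : C) (f : F X ~> Y), is_iso f.
Proof.
move=> [G [_ [[a ha]]]] Y; exists (G Y), (a Y); exact: ha.
Qed.

Lemma ff_surj_equivalence :
  (forall A B : C, bijective (@fmap _ _ F A B)) ->
  (forall Y : D, exists (X : C) (f : F X ~> Y), is_iso f) ->
  is_equivalence F.
Proof.
move=> ff es.
have inj A B : injective (@fmap _ _ F A B) := bij_inj (ff A B).
have full A B (y : F A ~> F B) : exists x, fmap F x = y.
  by have [g _ fg] := ff A B; exists (g y).
pose G0 Y := proj1_sig (cid (es Y)).
pose e0 Y : F (G0 Y) ~> Y := proj1_sig (cid (proj2_sig (cid (es Y)))).
have he Y : is_iso (e0 Y) by exact: (proj2_sig (cid (proj2_sig (cid (es Y))))).
pose G1 Y Y' (y : Y ~> Y') : G0 Y ~> G0 Y' :=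
  proj1_sig (cid (full _ _ (iso_inv (he Y') ∘ (y ∘ e0 Y)))).
have G1E Y Y' (y : Y ~> Y') : fmap F (G1 _ _ y) = iso_inv (he Y') ∘ (y ∘ e0 Y).
  exact: (proj2_sig (cid (full _ _ _))).
have Gi Y : G1 _ _ (idm Y) = idm (G0 Y).
  by apply: inj; rewrite G1E comp_idl iso_invl fmap_id.
have Gc X Y Z (g : Y ~> Z) (f : X ~> Y) : G1 _ _ (g ∘ f) = G1 _ _ g ∘ G1 _ _ f.
  apply: inj; rewrite fmap_comp !G1E -!comp_assoc.
  by rewrite (comp_assoc (e0 Y)) iso_invr comp_idl.
pose G := Build_Functor Gi Gc; exists G.
pose u0 X : X ~> G0 (F X) := proj1_sig (cid (full _ _ (iso_inv (he (F X))))).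
have u0E X : fmap F (u0 X) = iso_inv (he (F X)).
  exact: (proj2_sig (cid (full _ _ _))).
have un X Y (f : X ~> Y) : u0 Y ∘ fmap (idF C) f = fmap (G ∘F F) f ∘ u0 X.
  apply: inj; rewrite !fmap_comp /= G1E !u0E -!comp_assoc.
  by rewrite iso_invr comp_idr.
have ui X : is_iso (u0 X).
  have [v ev] := full _ _ (e0 (F X)); exists v; split; apply: inj.
    by rewrite fmap_comp u0E ev iso_invr fmap_id.
  by rewrite fmap_comp u0E ev iso_invl fmap_id.
have en X Y (f : X ~> Y) : e0 Y ∘ fmap (F ∘F G) f = fmap (idF D) f ∘ e0 X.
  by rewrite /= G1E comp_assoc iso_invr comp_idl.
split; constructor.
  exact: (@Build_NatIso _ _ (idF C) (G ∘F F)
    (@Build_NatTrans _ _ (idF C) (G ∘F F) u0 un) ui).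
exact: (@Build_NatIso _ _ (F ∘F G) (idF D)
  (@Build_NatTrans _ _ (F ∘F G) (idF D) e0 en) he).
Qed.
End Equivalence.

Lemma modification_iso (D : Category) (P Q : IndexedCat D) (S T : IndHom P Q)
    (a : S ~> T) : (forall I X, is_iso (md a I X)) -> is_iso a.
Proof.
move=> ha.
have bn I X Y (f : X ~> Y) : iso_inv (ha I Y) ∘ fmap (pn T I) f =
    fmap (pn S I) f ∘ iso_inv (ha I X).
  apply: (iso_epi (ha I X)); rewrite -!comp_assoc iso_invl comp_idr.
  by rewrite -(nt_nat (md a I) f) comp_assoc iso_invl comp_idl.
pose b0 I := @Build_NatTrans _ _ (pn T I) (pn S I) (fun X => iso_inv (ha I X)) (bn I).
have bc (I J : D) (f : J ~> I) (X : P I) :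
    b0 J (reindex P f X) ∘ pn_iso T f X =
    pn_iso S f X ∘ fmap (reindex Q f) (b0 I X).
  apply: (iso_epi (iso_fmap (reindex Q f) (ha I X))).
  rewrite -!comp_assoc -fmap_comp iso_invl fmap_id comp_idr.
  by rewrite -(md_compat a f X) comp_assoc iso_invl comp_idl.
exists (@Build_Modification D P Q T S b0 bc).
split; apply: modification_ext => I X /=; first exact: iso_invl.
exact: iso_invr.
Qed.

(** * Sheaves and descent data *)

Section Sheaves.
Context (C D : Category) (i : Functor C D).

Lemma restrictedYonedaHom_ext (I X : D) (a b : RestrictedYonedaHom i I X) :
  (forall A f, a A f = b A f) -> a = b.
Proof.
case: a b => [a na] [b nb] /= h.
have e : a = b.
  apply: functional_extensionality_dep => A.
  by apply: functional_extensionality_dep => f.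
by case: _ / e nb {h} => nb; rewrite (Prop_irrelevance na nb).
Qed.

Lemma sheaf_ext (X : D) : is_sheaf i X -> forall (I : D) (g g' : I ~> X),
  (forall (A : C) (f : i A ~> I), g ∘ f = g' ∘ f) -> g = g'.
Proof.
move=> hX I g g' h; apply: (bij_inj (hX I)).
exact: restrictedYonedaHom_ext.
Qed.

Lemma sheaf_glue (X : D) : is_sheaf i X ->
  forall (I : D) (phi : forall A : C, (i A ~> I) -> (i A ~> X)),
  (forall (A B : C) (u : A ~> B) (f : i B ~> I),
    phi A (f ∘ fmap i u) = phi B f ∘ fmap i u) ->
  exists g : I ~> X, forall (A : C) (f : i A ~> I), g ∘ f = phi A f.
Proof.
move=> hX I phi nphi; have [k _ ck] := hX I.
exists (k (@Build_RestrictedYonedaHom _ _ _ _ _ phi nphi)) => A f.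
set r := Build_RestrictedYonedaHom _.
by rewrite -[phi A f]/(r A f) -[in RHS](ck r).
Qed.

Lemma sheaf_intro (X : D) :
  (forall (I : D) (g g' : I ~> X),
    (forall (A : C) (f : i A ~> I), g ∘ f = g' ∘ f) -> g = g') ->
  (forall (I : D) (phi : forall A : C, (i A ~> I) -> (i A ~> X)),
    (forall (A B : C) (u : A ~> B) (f : i B ~> I),
      phi A (f ∘ fmap i u) = phi B f ∘ fmap i u) ->
    exists g : I ~> X, forall (A : C) (f : i A ~> I), g ∘ f = phi A f) ->
  is_sheaf i X.
Proof.
move=> ext glue I.
have ex (r : RestrictedYonedaHom i I X) :
    exists g : I ~> X, forall A (f : i A ~> I), g ∘ f = r A f.
  exact: (glue I (ry r) (@ry_nat _ _ _ _ _ r)).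
exists (fun r => proj1_sig (cid (ex r))).
  by move=> g; case: cid => g' /= hg'; apply: ext.
move=> r; case: cid => g' /= hg'; exact: restrictedYonedaHom_ext.
Qed.
End Sheaves.

Section Descent.
Context (C D : Category) (i : Functor C D).

(** A functor on the category of objects of [C] over [I], together with a
    cartesian transformation to the projection.  The maps are indexed by proofs
    of equality of composites, so that functoriality is an equation between
    morphisms with the same source and target. *)
Record descent_datum (I : D) : Type := {
  dd : forall J : C, (i J ~> I) -> D;
  dd_proj : forall (J : C) (f : i J ~> I), dd f ~> i J;
  dd_map : forall (J K : C) (u : K ~> J) (f : i J ~> I) (f' : i K ~> I),
    f ∘ fmap i u = f' -> dd f' ~> dd f;
  dd_pullback : forall (J K : C) (u : K ~> J) (f : i J ~> I) (f' : i K ~> I)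
    (e : f ∘ fmap i u = f'),
    is_pullback (fmap i u) (dd_proj f) (dd_proj f') (dd_map e);
  dd_comp : forall (J K M : C) (u : K ~> J) (v : M ~> K) (f : i J ~> I)
    (f' : i K ~> I) (f'' : i M ~> I) (e : f ∘ fmap i u = f')
    (e' : f' ∘ fmap i v = f'') (e'' : f ∘ fmap i (u ∘ v) = f''),
    dd_map e ∘ dd_map e' = dd_map e'' }.

Definition effective (I : D) (X : descent_datum I) : Prop :=
  exists (E : D) (q : E ~> I) (c : forall (J : C) (f : i J ~> I), dd X f ~> E),
    (forall (J : C) (f : i J ~> I), is_pullback f q (dd_proj X f) (c J f)) /\
    (forall (J K : C) (u : K ~> J) (f : i J ~> I) (f' : i K ~> I)
      (e : f ∘ fmap i u = f'), c J f ∘ dd_map X e = c K f').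

Section Datum.
Context (I : D) (X : descent_datum I).

Lemma dd_map_congr (J K : C) (u u' : K ~> J) (f : i J ~> I) (f' : i K ~> I)
    (e : f ∘ fmap i u = f') (e' : f ∘ fmap i u' = f') :
  u = u' -> dd_map X e = dd_map X e'.
Proof. by move=> eu; case: _ / eu e' => e'; rewrite (Prop_irrelevance e e'). Qed.

(** Preservation of identities is a consequence of functoriality on
    composites: the map over an identity is idempotent, and monic as a pullback
    of an isomorphism. *)
Lemma dd_map_id (J : C) (f : i J ~> I) (e : f ∘ fmap i (idm J) = f) :
  dd_map X e = idm (dd X f).
Proof.
apply: (pullback_jointly_monic (dd_pullback X e)).
  by rewrite -(dd_pullback X e).1 fmap_id comp_idl comp_idr.
have e' : f ∘ fmap i (idm J ∘ idm J) = f by rewrite comp_idl.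
rewrite (dd_comp X e e e') [RHS]comp_idr.
exact/dd_map_congr/comp_idl.
Qed.
End Datum.
End Descent.

Lemma heq_sfun (C : Category) (I : C) (X Y X' Y' : slice I) (f : X ~> Y)
    (g : X' ~> Y') : heq f g -> heq (sfun f) (sfun g).
Proof. by case. Qed.

Lemma heq_discrete_fmap (T : Type) (C : Category) (F : Functor (discrete T) C)
    (x y : discrete T) (p : x ~> y) : heq (fmap F p) (idm (F x)).
Proof. by case: _ / p; rewrite (fmap_id F x). Qed.

Lemma heq_discrete_fmapl (T : Type) (C : Category) (F : Functor (discrete T) C)
    (x y : discrete T) (p : x ~> y) (Z : C) (g : Z ~> F x) :
  heq (fmap F p ∘ g) g.
Proof. by case: _ / p; rewrite (fmap_id F x) comp_idl. Qed.

Lemma slice_is_iso (C : Category) (I : C) (X Y : slice I) (f : X ~> Y) :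
  is_iso (sfun f) -> is_iso f.
Proof. by move=> [g [gf fg]]; apply: (slice_iso gf fg). Qed.

Lemma slice_iso_sfun (C : Category) (I : C) (X Y : slice I) (f : X ~> Y) :
  is_iso f -> is_iso (sfun f).
Proof.
by move=> [g [gf fg]]; exists (sfun g); split;
  [rewrite -[LHS]/(sfun (g ∘ f)) gf|rewrite -[LHS]/(sfun (f ∘ g)) fg].
Qed.

(** The structure isomorphisms of a restricted indexed category are cast along
    the functor equations, of which [e] stands for one here and below. *)
Lemma slice_unit_cast1 (C : Category) (L : FinLimits C) (I : C) (X : slice I)
    (k : I ~> I) (e : idm I = k) :
  pb1 L (smap X) k ∘
    sfun (castNI (R := fun f => slice_reindex L f) e (slice_id L I) X) =
  idm (sdom X).
Proof. by case: _ / e; exact: slice_unit1. Qed.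

Lemma slice_mult_cast1 (C : Category) (L : FinLimits C) (I J K : C)
    (X : slice I) (f : J ~> I) (g : K ~> J) (k : K ~> I) (e : f ∘ g = k) :
  pb1 L (smap X) k ∘
    sfun (castNI (R := fun h => slice_reindex L h) e (slice_comp L f g) X) =
  pb1 L (smap X) f ∘ pb1 L (smap (slice_pb L f X)) g.
Proof. by case: _ / e; exact: slice_mult1. Qed.

(** * The stack condition as effectiveness of descent data *)

Section StackEffective.
Context (C D : Category) (i : Functor C D) (L : FinLimits D).
Let P := self_indexing L.

(** A descent datum gives a pseudonatural family of objects of the slices,
    the comparison maps from the chosen pullbacks being induced by the
    cartesian squares of the datum. *)
Section Datum.
Context (I : D) (X : descent_datum i I).

Definition dd_slice (J : C) (f : i J ~> I) : slice (i J) :=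
  {| sdom := dd X f; smap := dd_proj X f |}.

Let pnF (J : C) : Functor (restrict i (yoneda I) J) (restrict i P J) :=
  discrete_functor (fun f : i J ~> I => dd_slice f).

Lemma dd_slice_gap_subproof (J K : C) (u : K ~> J) (f : i J ~> I) :
  fmap i u ∘ pb2 L (dd_proj X f) (fmap i u) =
  dd_proj X f ∘ pb1 L (dd_proj X f) (fmap i u).
Proof. exact: esym (pb_pullback L _ _).1. Qed.

Definition dd_slice_gap (J K : C) (u : K ~> J) (f : i J ~> I) :
  slice_pb L (fmap i u) (dd_slice f) ~> dd_slice (f ∘ fmap i u) :=
  {| sfun := gap (dd_pullback X erefl) (dd_slice_gap_subproof u f)
        : sdom (slice_pb L (fmap i u) (dd_slice f)) ~>
          sdom (dd_slice (f ∘ fmap i u));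
     sfun_comm := gap1 (dd_pullback X erefl) (dd_slice_gap_subproof u f) |}.

Program Definition dd_pn_iso (J K : C) (u : K ~> J) :
    NatIso (reindex (restrict i P) u ∘F pnF J)
           (pnF K ∘F reindex (restrict i (yoneda I)) u) :=
  {| ni := {| nt := fun f : i J ~> I => dd_slice_gap u f |} |}.
Next Obligation. by move=> J K u; apply: discrete_natural. Qed.
Next Obligation.
move=> J K u f; apply: slice_is_iso.
apply: (pb_iso_of (dd_pullback X erefl) (pb_sym (pb_pullback L _ _))).
  exact: gap1.
exact: gap2.
Qed.

Lemma dd_slice_heq (J K : C) (u u' : K ~> J) (f : i J ~> I) (f1 f2 : i K ~> I)
    (e1 : f ∘ fmap i u = f1) (e2 : f ∘ fmap i u' = f2) (A : slice (i K))
    (a : A ~> dd_slice f1) (b : A ~> dd_slice f2) : u = u' ->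
  dd_map X e1 ∘ sfun a = dd_map X e2 ∘ sfun b -> heq a b.
Proof.
move=> eu; case: _ / eu e2 => e2; case: _ / e2 e1 b => e1.
case: _ / e1 a => a b e; apply/eq_heq/sliceHom_ext.
apply: (pullback_jointly_monic (dd_pullback X erefl) _ e).
by rewrite (sfun_comm a) (sfun_comm b).
Qed.

Program Definition dd_pn : PseudoNat (restrict i (yoneda I)) (restrict i P) :=
  {| pn := pnF; pn_iso := dd_pn_iso |}.
Next Obligation.
move=> J f; apply: heq_eq; apply: heq_trans (heq_sym (heq_discrete_fmap _ _)).
have e2 : f ∘ fmap i (idm J) = f by rewrite fmap_id comp_idr.
apply: (dd_slice_heq (e1 := erefl) (e2 := e2)) => //.
rewrite dd_map_id comp_idl /= comp_assoc [dd_map X _ ∘ _]gap2.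
exact: (slice_unit_cast1 L (dd_slice f)).
Qed.
Next Obligation.
move=> J K M u v f; apply: heq_eq.
rewrite -comp_assoc; set W := (X in _ (_ ∘ X)).
have := @heq_discrete_fmapl _ _ (pnF M) _ _
  (icomp (restrict i (yoneda I)) u v f) _ W.
move=> /heq_sym; apply: heq_trans.
have e2 : f ∘ fmap i (u ∘ v) = (f ∘ fmap i u) ∘ fmap i v.
  by rewrite fmap_comp comp_assoc.
apply: (dd_slice_heq (e1 := erefl) (e2 := e2)) => //.
rewrite -(dd_comp X erefl erefl e2) /= comp_assoc [dd_map X _ ∘ _]gap2.
apply: etrans (slice_mult_cast1 L (dd_slice f) _) _.
rewrite -comp_assoc (comp_assoc (dd_map X _) (gap _ _)) [X in _ = _ ∘ (X ∘ _)]gap2.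
rewrite (slice_map1 L (fmap i v) (dd_slice_gap u f)) comp_assoc /=.
by congr (_ ∘ _); apply: esym; exact: gap2.
Qed.
End Datum.

(** Applying the stack condition to the pseudonatural family of a datum gives an
    object whose chosen pullbacks are isomorphic to the members of the datum;
    transporting the chosen projections makes it a glueing. *)
Lemma stack_effective (I : D) (X : descent_datum i I) :
  is_stack i P -> effective X.
Proof.
move=> /(_ I)/equivalence_surj/(_ (dd_pn X))[E [a [b [ba ab]]]].
have bK J (f : i J ~> I) : is_iso (sfun (md b J f)).
  apply: slice_iso_sfun; exists (md a J f); split.
    exact: (congr1 (fun m : Modification (dd_pn X) (dd_pn X) => md m J f) ab).
  exact: (congr1 (fun m : Modification (canonical_pn i E) (canonical_pn i E) =>
    md m J f) ba).
pose c J (f : i J ~> I) : dd X f ~> sdom E :=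
  pb1 L (smap E) f ∘ sfun (md b J f).
have pbc J (f : i J ~> I) : is_pullback f (smap E) (dd_proj X f) (c J f).
  rewrite -[dd_proj X f]/(smap (dd_slice X f)) -(sfun_comm (md b J f)).
  apply: pb_precomp_iso (bK J f); exact: pb_sym (pb_pullback L _ _).
exists (sdom E), (smap E), c; split=> // J K u f f' e; case: _ / e.
have hg := slice_iso_sfun (ni_iso (dd_pn_iso X u) f).
apply: (iso_epi hg); rewrite -comp_assoc [dd_map X _ ∘ _]gap2.
have := congr1 (@sfun _ _ _ _) (md_compat b u f).
rewrite /c -!comp_assoc => h.
rewrite [X in _ = _ ∘ X]h /=.
transitivity (pb1 L (smap E) f ∘ (pb1 L (smap (slice_pb L f E)) (fmap i u)
    ∘ sfun (slice_map L (fmap i u) (md b J f)))).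
  by rewrite (slice_map1 L (fmap i u) (md b J f)) comp_assoc.
rewrite [LHS]comp_assoc [RHS]comp_assoc; congr (_ ∘ _).
exact: esym (slice_mult1 L f (fmap i u) E).
Qed.
End StackEffective.

Section EffectiveStack.
Context (C D : Category) (i : Functor C D) (L : FinLimits D).
Context (full : forall (A B : C) (g : i A ~> i B),
  exists u : A ~> B, fmap i u = g).
Context (sheaf : forall X : D, is_sheaf i X).
Context (eff : forall (I : D) (X : descent_datum i I), effective X).
Let P := self_indexing L.

Section FullyFaithful.
Context (I : D) (X Y : slice I).

(** The components of a modification between representable families commute
    with change of base; on generalized elements of the chosen pullbacks this
    says that the value depends only on the element of [X] and not on the
    object of [C] over which it is seen. *)
Lemma modification_local
    (m : Modification (canonical_pn i (P := P) X) (canonical_pn i (P := P) Y))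
    (J K : C) (u : K ~> J) (f : i J ~> I) (f' : i K ~> I)
    (Z : D) (y' : Z ~> pb L (smap X) f') (y : Z ~> pb L (smap X) f) :
  f ∘ fmap i u = f' ->
  pb1 L (smap X) f' ∘ y' = pb1 L (smap X) f ∘ y ->
  fmap i u ∘ (pb2 L (smap X) f' ∘ y') = pb2 L (smap X) f ∘ y ->
  pb1 L (smap Y) f' ∘ (sfun (md m K f') ∘ y') =
  pb1 L (smap Y) f ∘ (sfun (md m J f) ∘ y).
Proof.
move=> ef; case: _ / ef y' => y' e1 e2.
have pw := pb_pullback L (smap (slice_pb L f X)) (fmap i u).
pose w := gap pw (esym e2).
have e : y' = sfun (slice_mult L f (fmap i u) X) ∘ w.
  apply: (pullback_jointly_monic (pb_pullback L (smap X) (f ∘ fmap i u))).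
    rewrite e1 [RHS]comp_assoc [X in _ = X ∘ _](slice_mult1 L f (fmap i u) X).
    by rewrite -comp_assoc gap1.
  rewrite [RHS]comp_assoc [X in _ = X ∘ _](sfun_comm (slice_mult L f (fmap i u) X)).
  by rewrite gap2.
have h := congr1 (@sfun _ _ _ _) (md_compat m u f); simpl in h.
rewrite e (comp_assoc _ _ w) [X in _ ∘ (X ∘ _)]h.
rewrite -[y](gap1 pw (esym e2)) -/w.
transitivity (pb1 L (smap Y) f ∘ (pb1 L (smap (slice_pb L f Y)) (fmap i u)
    ∘ sfun (slice_map L (fmap i u) (md m J f))) ∘ w).
  rewrite [LHS]comp_assoc; congr (_ ∘ w).
  rewrite [LHS]comp_assoc [RHS]comp_assoc; congr (_ ∘ _).
  exact: (slice_mult1 L f (fmap i u) Y).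
by rewrite (slice_map1 L (fmap i u) (md m J f)) -!comp_assoc.
Qed.

(** A generalized element [g] of [X] corresponds to a section of the pullback of
    [X] along [smap X ∘ g], so a map out of [X] is determined by its pullbacks. *)
Lemma canonical_faithful (x x' : X ~> Y) :
  fmap (canonical i P I) x = fmap (canonical i P I) x' -> x = x'.
Proof.
move=> e; apply: sliceHom_ext; apply: (sheaf_ext (sheaf (sdom Y))) => J g.
have ex : smap X ∘ g = (smap X ∘ g) ∘ idm _ by rewrite comp_idr.
pose s := gap (pb_pullback L (smap X) (smap X ∘ g)) ex.
have ee : slice_map L (smap X ∘ g) x = slice_map L (smap X ∘ g) x'.
  exact: (congr1 (fun m : Modification (canonical_pn i (P := P) X)
    (canonical_pn i (P := P) Y) => md m J (smap X ∘ g)) e).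
rewrite -(gap1 (pb_pullback L (smap X) (smap X ∘ g)) ex) -/s !comp_assoc.
by rewrite -!(slice_map1 L) ee.
Qed.

(** Conversely, evaluating the modification on these sections gives a
    compatible family of elements of [Y], which glues because [Y] is a sheaf. *)
Lemma canonical_full
    (m : Modification (canonical_pn i (P := P) X) (canonical_pn i (P := P) Y)) :
  exists x : X ~> Y, fmap (canonical i P I) x = m.
Proof.
have ex J (g : i J ~> sdom X) : smap X ∘ g = (smap X ∘ g) ∘ idm _.
  by rewrite comp_idr.
pose s J (g : i J ~> sdom X) := gap (pb_pullback L (smap X) (smap X ∘ g)) (ex J g).
pose phi J (g : i J ~> sdom X) : i J ~> sdom Y :=
  pb1 L (smap Y) (smap X ∘ g) ∘ (sfun (md m J (smap X ∘ g)) ∘ s J g).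
have phin (J K : C) (u : J ~> K) (g : i K ~> sdom X) :
    phi J (g ∘ fmap i u) = phi K g ∘ fmap i u.
  rewrite /phi -!comp_assoc; apply: (@modification_local _ _ _ u).
  - by rewrite comp_assoc.
  - by rewrite /s gap1 comp_assoc gap1.
  - by rewrite /s gap2 comp_assoc gap2 comp_idl comp_idr.
have [t ht] := sheaf_glue (sheaf (sdom Y)) phin.
have tI : smap Y ∘ t = smap X.
  apply: (sheaf_ext (sheaf I)) => J g; rewrite -comp_assoc ht /phi.
  rewrite comp_assoc (pb_pullback L (smap Y) (smap X ∘ g)).1 -comp_assoc.
  rewrite [X in _ ∘ X]comp_assoc [X in _ ∘ (X ∘ _)](sfun_comm (md m J (smap X ∘ g))).
  by rewrite [X in _ ∘ X](gap2 (pb_pullback L (smap X) (smap X ∘ g))) comp_idr.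
exists {| sfun := t; sfun_comm := tI |}.
apply: modification_ext => J f; apply: slice_pb_eq => /=.
rewrite (slice_map1 L f {| sfun := t; sfun_comm := tI |}) /=.
apply: (sheaf_ext (sheaf (sdom Y))) => K y.
rewrite -comp_assoc ht /phi -[RHS]comp_assoc.
have [u eu] := full (pb2 L (smap X) f ∘ y).
apply: (@modification_local _ _ _ u).
- by rewrite eu !comp_assoc (pb_pullback L (smap X) f).1.
- by rewrite /s gap1.
- by rewrite /s gap2 comp_idr.
Qed.
End FullyFaithful.

(** A pseudonatural family [S] of objects of slices yields a descent datum: the
    total spaces of its members, with the inverse coherence isomorphisms
    followed by the projections of the chosen pullbacks. *)
Section Essential.
Context (I : D) (S : PseudoNat (restrict i (yoneda I)) (restrict i P)).

Let X (J : C) (f : i J ~> I) : slice (i J) := pn S J f.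

Let theta (J K : C) (u : K ~> J) (f : i J ~> I) :
    slice_pb L (fmap i u) (X f) ~> X (f ∘ fmap i u) := pn_iso S u f.

Let theta_iso (J K : C) (u : K ~> J) (f : i J ~> I) : is_iso (sfun (theta u f)).
Proof. exact: slice_iso_sfun (ni_iso (pn_iso S u) f). Qed.

Let smap_map (J K : C) (u : K ~> J) (f : i J ~> I) (f' : i K ~> I)
    (e : f ∘ fmap i u = f') : sdom (X f') ~> sdom (X f) :=
  match e in _ = f0 return sdom (X f0) ~> sdom (X f) with
  | erefl => pb1 L (smap (X f)) (fmap i u) ∘ iso_inv (theta_iso u f)
  end.

Let smap_mapE (J K : C) (u : K ~> J) (f : i J ~> I) (f' : i K ~> I)
    (e : f ∘ fmap i u = f') (Z : D) (a : Z ~> sdom (X f'))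
    (b : Z ~> sdom (slice_pb L (fmap i u) (X f))) :
  heq a (sfun (theta u f) ∘ b) ->
  smap_map e ∘ a = pb1 L (smap (X f)) (fmap i u) ∘ b.
Proof.
case: _ / e a => a /heq_eq -> /=.
by rewrite -comp_assoc (comp_assoc (iso_inv _)) iso_invl comp_idl.
Qed.

Let smap_pullback (J K : C) (u : K ~> J) (f : i J ~> I) (f' : i K ~> I)
    (e : f ∘ fmap i u = f') :
  is_pullback (fmap i u) (smap (X f)) (smap (X f')) (smap_map e).
Proof.
case: _ / e => /=.
have -> : smap (X (f ∘ fmap i u)) =
    pb2 L (smap (X f)) (fmap i u) ∘ iso_inv (theta_iso u f).
  apply: (iso_epi (theta_iso u f)); rewrite -comp_assoc iso_invl comp_idr.
  exact: sfun_comm.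
apply: pb_precomp_iso (iso_iso_inv _); exact: pb_sym (pb_pullback L _ _).
Qed.

Let smap_comp (J K M : C) (u : K ~> J) (v : M ~> K) (f : i J ~> I)
    (f' : i K ~> I) (f'' : i M ~> I) (e : f ∘ fmap i u = f')
    (e' : f' ∘ fmap i v = f'') (e'' : f ∘ fmap i (u ∘ v) = f'') :
  smap_map e ∘ smap_map e' = smap_map e''.
Proof.
case: _ / e e' => e'; case: _ / e' e'' => e''.
pose A := sfun (slice_map L (fmap i v) (theta u f)).
have hA : is_iso (sfun (theta v (f ∘ fmap i u)) ∘ A).
  apply: iso_comp; first exact: theta_iso.
  apply: slice_iso_sfun.
  exact: (iso_fmap (slice_reindex L (fmap i v)) (ni_iso (pn_iso S u) f)).
apply: (iso_epi hA).
rewrite -comp_assoc (smap_mapE (erefl (f ∘ fmap i u ∘ fmap i v)) (b := A)) //.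
rewrite [X in _ ∘ X](slice_map1 L (fmap i v) (theta u f)) [LHS]comp_assoc.
rewrite (smap_mapE (erefl (f ∘ fmap i u)) (b := idm _)); last first.
  by apply: eq_heq; rewrite comp_idr.
rewrite comp_idr.
have h := pn_comp S u v f.
pose k : slice_pb L (fmap i v) (slice_pb L (fmap i u) (X f)) ~>
    slice_pb L (fmap i (u ∘ v)) (X f) :=
  icomp (restrict i P) u v (pn S J f).
rewrite (smap_mapE e'' (b := sfun k)).
  exact: esym (slice_mult_cast1 L (X f) _).
have {}h := heq_sfun (eq_heq h).
move: (heq_sym h); apply: heq_trans.
set W := pn_iso S v _.
have := @heq_discrete_fmapl _ _ (pn S M) _ _ (icomp (restrict i (yoneda I)) u v f) _
  (W ∘ fmap (reindex (restrict i P) v) (pn_iso S u f)).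
move=> /heq_sym/heq_sfun; rewrite comp_assoc; exact: heq_trans.
Qed.

Let D0 : descent_datum i I :=
  {| dd := fun J f => sdom (X f); dd_proj := fun J f => smap (X f);
     dd_map := smap_map; dd_pullback := smap_pullback;
     dd_comp := smap_comp |}.

Lemma canonical_surj : exists (E : slice I) (a : canonical i P I E ~> S), is_iso a.
Proof.
have [E [q [c [cpb cmap]]]] := eff D0.
pose e : slice I := {| sdom := E; smap := q |}.
have gE (J : C) (f : i J ~> I) : f ∘ pb2 L q f = q ∘ pb1 L q f.
  exact: esym (pb_pullback L q f).1.
pose a0 (J : C) (f : i J ~> I) : slice_pb L f e ~> X f :=
  {| sfun := gap (cpb J f) (gE J f) : sdom (slice_pb L f e) ~> sdom (X f);
     sfun_comm := gap1 (cpb J f) (gE J f) |}.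
have an (J : C) (f f' : restrict i (yoneda I) J) (p : f ~> f') :
    a0 J f' ∘ fmap (canonical_at i (P := P) e J) p = fmap (pn S J) p ∘ a0 J f.
  exact: discrete_natural.
pose a1 J := @Build_NatTrans _ _ (canonical_at i (P := P) e J) (pn S J) (a0 J) (an J).
have ac (J K : C) (u : K ~> J) (f : restrict i (yoneda I) J) :
    a1 K (reindex (restrict i (yoneda I)) u f) ∘ canonical_iso i (P := P) e u f =
    pn_iso S u f ∘ fmap (reindex (restrict i P) u) (a1 J f).
  apply: sliceHom_ext.
  pose l := slice_mult L f (fmap i u) e.
  pose r := slice_map L (fmap i u) (a0 J f).
  apply: (pullback_jointly_monic (cpb K (f ∘ fmap i u))).
    apply: etrans (sfun_comm (a0 K (f ∘ fmap i u) ∘ l)) _.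
    exact: esym (sfun_comm (theta u f ∘ r)).
  rewrite -[sfun (pn_iso S u f ∘ _)]/(sfun (theta u f) ∘ sfun r).
  rewrite -[sfun (a1 K _ ∘ _)]/(sfun (a0 K (f ∘ fmap i u)) ∘ sfun l).
  rewrite comp_assoc [X in X ∘ _]gap2 (slice_mult1 L f (fmap i u) e).
  rewrite -(cmap _ _ _ _ _ (erefl (f ∘ fmap i u))) -[RHS]comp_assoc.
  rewrite (smap_mapE (erefl (f ∘ fmap i u)) (b := sfun r)) //.
  rewrite [X in _ = _ ∘ X](slice_map1 L (fmap i u) (a0 J f)) [RHS]comp_assoc.
  by congr (_ ∘ _); apply: esym; exact: gap2.
exists e, (@Build_Modification _ _ _ (canonical_pn i (P := P) e) S a1 ac).
apply: modification_iso => J f; apply: slice_is_iso.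
apply: (pb_iso_of (cpb J f) (pb_sym (pb_pullback L q f))); first exact: gap1.
exact: gap2.
Qed.
End Essential.

Lemma effective_stack : is_stack i P.
Proof.
move=> I; apply: ff_surj_equivalence; last exact: canonical_surj.
move=> X Y; exists (fun m => proj1_sig (cid (canonical_full m))).
  by move=> x; apply: canonical_faithful; case: cid.
by move=> m; case: cid.
Qed.
End EffectiveStack.

(** * Limits of coalgebras *)

Section Coalgebras.
Context (C : Category) (T : Comonad C).

Lemma cfun_comp (X Y Z : Coalg T) (g : Y ~> Z) (f : X ~> Y) :
  cfun (g ∘ f) = cfun g ∘ cfun f.
Proof. by []. Qed.

Lemma counit_nat (V W : C) (f : V ~> W) :
  counit T W ∘ fmap T f = f ∘ counit T V.
Proof. exact (nt_nat (counit T) f). Qed.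

Lemma comult_nat (V W : C) (f : V ~> W) :
  comult T W ∘ fmap T f = fmap T (fmap T f) ∘ comult T V.
Proof. exact (nt_nat (comult T) f). Qed.

Program Definition cofree (V : C) : Coalg T :=
  {| carrier := T V; coact := comult T V |}.
Next Obligation. by move=> V; exact: counit_l. Qed.
Next Obligation. by move=> V; exact: comult_assoc. Qed.

Definition cofree_map (V W : C) (f : V ~> W) : cofree V ~> cofree W :=
  {| cfun := fmap T f : carrier (cofree V) ~> carrier (cofree W);
     cfun_comm := comult_nat f |}.

Definition coact_map (X : Coalg T) : X ~> cofree (carrier X) :=
  {| cfun := coact X : carrier X ~> carrier (cofree (carrier X));
     cfun_comm := coact_comult X |}.

(** The coaction is split by the counit, although not by a coalgebra map. *)
Lemma coact_map_monic (X : Coalg T) : monic (coact_map X).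
Proof.
move=> Z a b /(congr1 (@cfun _ _ _ _)) /= e; apply: coalgHom_ext.
have := congr1 (comp (counit T (carrier X))) e.
by rewrite !comp_assoc coact_counit !comp_idl.
Qed.

Program Definition cofree_lift (X : Coalg T) (V : C) (v : carrier X ~> V) :
    X ~> cofree V :=
  {| cfun := (fmap T v ∘ coact X) : carrier X ~> carrier (cofree V) |}.
Next Obligation.
move=> X V v /=; rewrite comp_assoc comult_nat -comp_assoc coact_comult.
by rewrite comp_assoc -fmap_comp.
Qed.

Lemma cofree_liftE (X : Coalg T) (V : C) (v : carrier X ~> V) :
  counit T V ∘ cfun (cofree_lift v) = v.
Proof. by rewrite /= comp_assoc counit_nat -comp_assoc coact_counit comp_idr. Qed.

Lemma cofree_lift_comp (X Y : Coalg T) (V : C) (v : carrier X ~> V) (f : Y ~> X) :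
  counit T V ∘ cfun (cofree_lift v ∘ f) = v ∘ cfun f.
Proof. by rewrite cfun_comp comp_assoc cofree_liftE. Qed.

Lemma cofree_ext (X : Coalg T) (V : C) (f g : X ~> cofree V) :
  counit T V ∘ cfun f = counit T V ∘ cfun g -> f = g.
Proof.
suff h (k : X ~> cofree V) : cfun k = fmap T (counit T V ∘ cfun k) ∘ coact X.
  by move=> e; apply: coalgHom_ext; rewrite (h f) (h g) e.
rewrite fmap_comp -comp_assoc -[fmap T (cfun k) ∘ _](cfun_comm k) comp_assoc /=.
by rewrite counit_r comp_idl.
Qed.

Lemma coalg_is_iso (X Y : Coalg T) (f : X ~> Y) : is_iso (cfun f) -> is_iso f.
Proof.
move=> [g [gf fg]].
have hg : coact X ∘ g = fmap T g ∘ coact Y.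
  have hf : is_iso (cfun f) by exists g.
  apply: (iso_epi hf); rewrite -!comp_assoc gf comp_idr.
  by rewrite cfun_comm comp_assoc -fmap_comp gf fmap_id comp_idl.
by exists {| cfun := g; cfun_comm := hg |}; split; apply: coalgHom_ext.
Qed.

Lemma coalg_iso_cfun (X Y : Coalg T) (f : X ~> Y) : is_iso f -> is_iso (cfun f).
Proof. exact: (iso_fmap (forget T)). Qed.

(** Coalgebra structure transported along an isomorphism of carriers. *)
Lemma coalg_transport (X : Coalg T) (A : C) (f : A ~> carrier X) : is_iso f ->
  exists (Y : Coalg T) (e : carrier Y = A) (k : Y ~> X),
    cfun k = f ∘ idto e /\ is_iso k.
Proof.
move=> [g [gf fg]].
have h1 : counit T A ∘ (fmap T g ∘ coact X ∘ f) = idm A.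
  by rewrite !comp_assoc counit_nat -(comp_assoc g) coact_counit comp_idr.
have h2 : comult T A ∘ (fmap T g ∘ coact X ∘ f) =
    fmap T (fmap T g ∘ coact X ∘ f) ∘ (fmap T g ∘ coact X ∘ f).
  rewrite !comp_assoc comult_nat -(comp_assoc (fmap T (fmap T g))) coact_comult.
  rewrite !comp_assoc -!fmap_comp -(comp_assoc _ f g) fg comp_idr.
  by rewrite -!comp_assoc.
pose Y : Coalg T := {| carrier := A; coact := fmap T g ∘ coact X ∘ f;
  coact_counit := h1; coact_comult := h2 |}.
have hk : coact X ∘ f = fmap T f ∘ coact Y.
  by rewrite /= !comp_assoc -fmap_comp fg fmap_id comp_idl.
pose k : Y ~> X := {| cfun := f : carrier Y ~> carrier X; cfun_comm := hk |}.
exists Y, erefl, k; split; first by rewrite /= comp_idr.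
by apply: coalg_is_iso; exists g.
Qed.
End Coalgebras.

Section CoalgebraLimits.
Context (C : Category) (L : FinLimits C) (T : Comonad C).
Context (hT : cartesian_functor T).
Let LT := coalg_lim L hT.

(** The chosen pullbacks of coalgebras have pullbacks of carriers as their
    carriers, and any pullback is isomorphic to the chosen one. *)
Lemma forget_pullback (A B X P : Coalg T) (f : A ~> X) (g : B ~> X)
    (p1 : P ~> A) (p2 : P ~> B) :
  is_pullback f g p1 p2 ->
  is_pullback (cfun f) (cfun g) (cfun p1) (cfun p2).
Proof.
move=> hP; have [k [hk <- <-]] := pb_compare (pb_pullback LT f g) hP.
apply: (pb_precomp_iso (k := cfun k)) (coalg_iso_cfun hk).
exact: (pb_pullback L (cfun f) (cfun g)).
Qed.

Lemma forget_reflects_pullback (A B X P : Coalg T) (f : A ~> X) (g : B ~> X)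
    (p1 : P ~> A) (p2 : P ~> B) :
  is_pullback (cfun f) (cfun g) (cfun p1) (cfun p2) ->
  is_pullback f g p1 p2.
Proof.
move=> hP.
have e : f ∘ p1 = g ∘ p2 by apply: coalgHom_ext; exact: hP.1.
have hQ := pb_pullback LT f g; pose k := gap hQ e.
suff hk : is_iso k by have := pb_precomp_iso hQ hk; rewrite /k gap1 gap2.
apply: coalg_is_iso; apply: (pb_iso_of (forget_pullback hQ) hP).
  by rewrite -cfun_comp gap1.
by rewrite -cfun_comp gap2.
Qed.

Lemma forget_terminal (A : Coalg T) : is_terminal A -> is_terminal (carrier A).
Proof.
move=> hA; pose k := to_terminal hA (top LT).
have [l [_ kl]] : is_iso (cfun k).
  exact/coalg_iso_cfun/terminal_iso/hA/top_terminal.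
move=> Z; exists (cfun k ∘ to_top L Z) => g.
rewrite -[g]comp_idl -kl -comp_assoc; congr (_ ∘ _).
exact: (to_terminal_uniq (top_terminal L)).
Qed.

Lemma forget_reflects_terminal (A : Coalg T) :
  is_terminal (carrier A) -> is_terminal A.
Proof.
move=> hA X.
have h : coact A ∘ to_terminal hA (carrier X) =
    fmap T (to_terminal hA (carrier X)) ∘ coact X.
  exact: (to_terminal_uniq (hT.1 _ hA)).
exists {| cfun := to_terminal hA (carrier X); cfun_comm := h |} => g.
by apply: coalgHom_ext; exact: (to_terminal_uniq hA).
Qed.

Lemma forget_monic (A B : Coalg T) (m : A ~> B) : monic m -> monic (cfun m).
Proof.
by move=> /monic_kernel_pair/forget_pullback/monic_kernel_pair.
Qed.

Lemma forget_product (A B P : Coalg T) (p1 : P ~> A) (p2 : P ~> B) :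
  is_product p1 p2 -> is_product (cfun p1) (cfun p2).
Proof.
move=> hP; apply: (@pb_product _ (top L) _ _ _ (cfun (to_top LT A))
  (cfun (to_top LT B))) (top_terminal L) _.
apply: (@forget_pullback A B (top LT) P (to_top LT A) (to_top LT B)).
split; first exact: (to_terminal_uniq (top_terminal LT)).
by move=> Q q1 q2 _; exact: hP.
Qed.

(** The largest subcoalgebra on which two maps out of the carrier agree: since
    they correspond to coalgebra maps to a cofree coalgebra, it is an
    equalizer. *)
Section Equalizer.
Context (X : Coalg T) (V : C) (a b : carrier X ~> V).

Definition coalg_eq : Coalg T :=
  pb LT (cpair LT (idm X) (cofree_lift a)) (cpair LT (idm X) (cofree_lift b)).

Definition coalg_eq_incl : coalg_eq ~> X := pb1 LT _ _.

Let eqP := pb_pullback LT (cpair LT (idm X) (cofree_lift a))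
  (cpair LT (idm X) (cofree_lift b)).

Lemma coalg_eq_comm : a ∘ cfun coalg_eq_incl = b ∘ cfun coalg_eq_incl.
Proof.
have [_ e] := graphs_pullback eqP.
rewrite -(cofree_lift_comp a) -(cofree_lift_comp b).
exact: (congr1 (fun k : coalg_eq ~> cofree T V => counit T V ∘ cfun k) e).
Qed.

Lemma coalg_eq_factor (Y : Coalg T) (f : Y ~> X) :
  a ∘ cfun f = b ∘ cfun f -> exists g : Y ~> coalg_eq, coalg_eq_incl ∘ g = f.
Proof.
move=> e; apply: (graphs_pullback_factor eqP); apply: cofree_ext.
by rewrite !cofree_lift_comp.
Qed.

Lemma coalg_eq_monic : monic coalg_eq_incl.
Proof. exact: graphs_pullback_monic eqP. Qed.
End Equalizer.
End CoalgebraLimits.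

(** * The topos of coalgebras *)

Section CoalgebraTopos.
Context (C : Category) (S : ToposStructure C) (T : Comonad C).
Context (hT : cartesian_functor T).
Let L := ts_lim S.
Let LT := coalg_lim L hT.

Section Exponential.
Context (A B : Coalg T).

(** Coalgebra maps [X ~> coexp] are just maps of carriers [X * A ~> B]. *)
Let coexp : Coalg T := cofree T (expo (ts_exp S) (carrier A) (carrier B)).

Let evc : carrier (cprod LT coexp A) ~> carrier B :=
  ev (ts_exp S) (carrier A) (carrier B) ∘
    cpair L (counit T _ ∘ cfun (cfst LT coexp A)) (cfun (csnd LT coexp A)).

Let forget_cprod (X : Coalg T) :
  is_product (cfun (cfst LT X A)) (cfun (csnd LT X A)).
Proof. exact/(forget_product L hT)/cprod_product. Qed.

Let curry (V : C) (f : carrier (cprod LT coexp A) ~> V) :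
    carrier coexp ~> expo (ts_exp S) (carrier A) V :=
  proj1_sig (cid (curry_product (ts_exp S) f (@forget_cprod coexp))).

Let curry_spec (V : C) (f : carrier (cprod LT coexp A) ~> V) :
  ev (ts_exp S) (carrier A) V ∘
    cpair L (curry f ∘ cfun (cfst LT coexp A)) (cfun (csnd LT coexp A)) = f.
Proof. exact: (proj2_sig (cid (curry_product _ _ _))).1. Qed.

Let cpair_prod_map (X Y : Coalg T) (V : C) (v : carrier Y ~> V) (g : X ~> Y) :
  cpair L (v ∘ cfun (cfst LT Y A)) (cfun (csnd LT Y A)) ∘ cfun (prod_map LT A g) =
  cpair L (v ∘ cfun g ∘ cfun (cfst LT X A)) (cfun (csnd LT X A)).
Proof.
rewrite cpair_comp -comp_assoc -2!cfun_comp /prod_map cpair_fst cpair_snd.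
by rewrite cfun_comp comp_assoc.
Qed.

Let curryE (V : C) (f : carrier (cprod LT coexp A) ~> V) (X : Coalg T)
    (g : X ~> coexp) :
  ev (ts_exp S) (carrier A) V ∘
    cpair L (curry f ∘ cfun g ∘ cfun (cfst LT X A)) (cfun (csnd LT X A)) =
  f ∘ cfun (prod_map LT A g).
Proof. by rewrite -{2}(curry_spec f) -[RHS]comp_assoc cpair_prod_map. Qed.

(* The transpose of [g : X ~> coexp] is [evc] composed with [g * A]; that it is
   a coalgebra map is an equation between two maps [X * A ~> T B], each of which
   is a map out of [coexp * A] composed with [g * A]. *)
Let lhs := curry (coact B ∘ evc).
Let rhs := curry (fmap T evc ∘ coact (cprod LT coexp A)).

(** [g] factors through the exponential when its transpose, a map of carriers
    [X * A ~> B], is a coalgebra map. *)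
Definition coalg_expo : Coalg T := coalg_eq L hT lhs rhs.

Let incl : coalg_expo ~> coexp := coalg_eq_incl L hT lhs rhs.

Let lhs_rhs (X : Coalg T) (g : X ~> coexp) :
  lhs ∘ cfun g = rhs ∘ cfun g <->
  coact B ∘ (evc ∘ cfun (prod_map LT A g)) =
    fmap T (evc ∘ cfun (prod_map LT A g)) ∘ coact (cprod LT X A).
Proof.
have -> : coact B ∘ (evc ∘ cfun (prod_map LT A g)) =
    coact B ∘ evc ∘ cfun (prod_map LT A g) by rewrite comp_assoc.
have -> : fmap T (evc ∘ cfun (prod_map LT A g)) ∘ coact (cprod LT X A) =
    fmap T evc ∘ coact (cprod LT coexp A) ∘ cfun (prod_map LT A g).
  rewrite fmap_comp -[LHS]comp_assoc -[RHS]comp_assoc; congr (_ ∘ _).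
  exact: esym (cfun_comm (prod_map LT A g)).
rewrite -!curryE -/lhs -/rhs; split=> [-> //|].
have [h [_ hu]] := curry_product (ts_exp S)
  (ev (ts_exp S) (carrier A) (T (carrier B)) ∘
    cpair L (rhs ∘ cfun g ∘ cfun (cfst LT X A)) (cfun (csnd LT X A)))
  (@forget_cprod X).
by move=> e; rewrite -(hu _ e) -(hu (rhs ∘ cfun g)).
Qed.

Let incl_comm : lhs ∘ cfun incl = rhs ∘ cfun incl.
Proof. exact: coalg_eq_comm. Qed.

Let ev_comm : coact B ∘ (evc ∘ cfun (prod_map LT A incl)) =
    fmap T (evc ∘ cfun (prod_map LT A incl)) ∘ coact (cprod LT coalg_expo A).
Proof. by apply/lhs_rhs; exact: incl_comm. Qed.

Definition coalg_ev : cprod LT coalg_expo A ~> B :=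
  {| cfun := (evc ∘ cfun (prod_map LT A incl))
       : carrier (cprod LT coalg_expo A) ~> carrier B;
     cfun_comm := ev_comm |}.

Let coalg_evE (X : Coalg T) (g : X ~> coalg_expo) :
  cfun (coalg_ev ∘ prod_map LT A g) =
  ev (ts_exp S) (carrier A) (carrier B) ∘
    cpair L (counit T _ ∘ cfun (incl ∘ g) ∘ cfun (cfst LT X A))
      (cfun (csnd LT X A)).
Proof.
have e : prod_map LT A incl ∘ prod_map LT A g = prod_map LT A (incl ∘ g).
  rewrite /prod_map cpair_comp -comp_assoc cpair_fst cpair_snd.
  by rewrite -comp_assoc.
rewrite cfun_comp -[cfun coalg_ev]/(evc ∘ cfun (prod_map LT A incl)).
rewrite -comp_assoc -cfun_comp e /evc -comp_assoc; congr (_ ∘ _).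
exact: cpair_prod_map.
Qed.

Lemma coalg_exp_universal (X : Coalg T) (f : cprod LT X A ~> B) :
  exists! g : X ~> coalg_expo, coalg_ev ∘ prod_map LT A g = f.
Proof.
have [v [ve vu]] := curry_product (ts_exp S) (cfun f) (@forget_cprod X).
have ev1 : evc ∘ cfun (prod_map LT A (cofree_lift v : X ~> coexp)) = cfun f.
  by rewrite -ve -comp_assoc cpair_prod_map cofree_liftE.
have := (lhs_rhs (cofree_lift v : X ~> coexp)).2; rewrite ev1.
move=> /(_ (cfun_comm f))/(@coalg_eq_factor _ L _ hT _ _ lhs rhs) [g eg].
exists g; split.
  by apply: coalgHom_ext; rewrite coalg_evE [incl ∘ g]eg cofree_liftE.
move=> g' /(congr1 (@cfun _ _ _ _)); rewrite coalg_evE => /vu e.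
have im : monic incl by exact: coalg_eq_monic.
apply: im; rewrite [LHS]eg; apply: cofree_ext; rewrite cofree_liftE; exact: e.
Qed.
End Exponential.

Definition coalg_exponentials : Exponentials LT :=
  {| expo := coalg_expo; ev := coalg_ev; exp_universal := coalg_exp_universal |}.

Section Classifier.
Let O := Omega (ts_sub S).
Let true_ : top L ~> O := truth (ts_sub S).
Let topC := top_terminal L.
Let topT := hT.1 _ topC.

Let Ttruth_monic : monic (fmap T true_).
Proof. by move=> Z g h _; exact: (to_terminal_uniq topT). Qed.

(** For a coalgebra [X] and [chi : X ~> O], the composite of [tau], [T chi] and
    the coaction classifies the largest subcoalgebra contained in the subobject
    classified by [chi]. *)
Let tau_sig := cid (classify (ts_sub S) Ttruth_monic).
Let tau : T O ~> O := proj1_sig tau_sig.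
Let tauP : is_pullback tau true_ (fmap T true_) (to_top L _) :=
  (proj2_sig tau_sig).1.

(** Coalgebra maps to [cofree T O] correspond to subobjects of the carrier, and
    those on which [counit T O] and [tau] agree to the subobjects equal to the
    largest subcoalgebra they contain. *)
Definition coalg_Omega : Coalg T :=
  coalg_eq L hT (X := cofree T O) (counit T O) tau.

Let incl : coalg_Omega ~> cofree T O := coalg_eq_incl L hT _ _.

Let incl_lift (X : Coalg T) (t : X ~> coalg_Omega) (v : carrier X ~> O) :
  incl ∘ t = cofree_lift v -> counit T O ∘ cfun incl ∘ cfun t = v.
Proof.
move=> e; rewrite -comp_assoc -[cfun incl ∘ _]/(cfun (incl ∘ t)) e.
exact: cofree_liftE.
Qed.

Let incl_comm : counit T O ∘ cfun incl = tau ∘ cfun incl :=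
  coalg_eq_comm L hT _ _.

Lemma coalg_truth_ex : exists t : top LT ~> coalg_Omega,
  incl ∘ t = cofree_lift (true_ : carrier (top LT) ~> O).
Proof.
apply: coalg_eq_factor; rewrite cofree_liftE /= comp_assoc tauP.1 -comp_assoc.
by rewrite -[LHS]comp_idr; congr (_ ∘ _); exact: (to_terminal_uniq topC).
Qed.

Definition coalg_truth : top LT ~> coalg_Omega := proj1_sig (cid coalg_truth_ex).

Let coalg_truthE : incl ∘ coalg_truth =
  cofree_lift (true_ : carrier (top LT) ~> O).
Proof. exact: (proj2_sig (cid coalg_truth_ex)). Qed.

Let incl_mono : monic incl.
Proof. exact: coalg_eq_monic. Qed.

Let incl_monic : monic (cfun incl).
Proof. exact/(forget_monic L hT)/incl_mono. Qed.

Let Omega_pullback : is_pullback (counit T O ∘ cfun incl) true_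
  (cfun coalg_truth) (to_top L (carrier (top LT))).
Proof.
have eid : to_top L (carrier (top LT)) = idm _.
  exact: (to_terminal_uniq topC).
have te : cfun incl ∘ cfun coalg_truth = fmap T true_ ∘ coact (top LT).
  by rewrite -cfun_comp coalg_truthE.
apply: pb_intro.
- rewrite eid comp_idr -comp_assoc te.
  exact: (@cofree_liftE _ T (top LT) O true_).
- move=> Z a b e; exists b; split; last exact: (to_terminal_uniq topC).
  have e' : tau ∘ (cfun incl ∘ a) = true_ ∘ b by rewrite comp_assoc -incl_comm.
  apply: incl_monic; rewrite -(gap1 tauP e') comp_assoc te -comp_assoc.
  by congr (_ ∘ _); exact: (to_terminal_uniq topT).
- by move=> Z h k _ _; exact: (to_terminal_uniq topC).
Qed.

(** If the coaction sends an element of [X] into [T U], then the counit brings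
    the result back to an element of [U], which is the given one. *)
Lemma subcoalgebra_pullback (U X : Coalg T) (m : U ~> X) : monic (cfun m) ->
  is_pullback (coact X) (fmap T (cfun m)) (cfun m) (coact U).
Proof.
move=> hm.
have hTm : monic (fmap T (cfun m)).
  apply/monic_kernel_pair; rewrite -fmap_id.
  exact/(hT.2 _ _ _ _ _ _ _ _)/monic_kernel_pair.
apply: pb_intro; first exact: cfun_comm.
- move=> Z a b e; have ea : cfun m ∘ (counit T _ ∘ b) = a.
    rewrite comp_assoc -counit_nat -comp_assoc -e comp_assoc coact_counit.
    by rewrite comp_idl.
  exists (counit T _ ∘ b); split=> //.
  by apply: hTm; rewrite comp_assoc -cfun_comm -comp_assoc ea.
- by move=> Z h k /hm.
Qed.

(** For a subcoalgebra classified by [chi] on carriers, the coaction square of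
    [subcoalgebra_pullback] pasted with [T] of the classifying square shows that
    [tau] fixes [chi], so that [chi] lifts to [coalg_Omega]. *)
Lemma coalg_classify (U X : Coalg T) (m : U ~> X) : monic m ->
  exists! chi : X ~> coalg_Omega, is_pullback chi coalg_truth m (to_top LT U).
Proof.
move=> /(forget_monic L hT) hm.
have [chi [chiP chiU]] := classify (ts_sub S) hm.
have e : chi = tau ∘ (fmap T chi ∘ coact X).
  apply: chiU; rewrite comp_assoc.
  have -> : to_top L (carrier U) = to_top L (T (top L)) ∘
      (fmap T (to_top L (carrier U)) ∘ coact U).
    exact: (to_terminal_uniq topC).
  rewrite comp_assoc; apply: pb_paste (subcoalgebra_pullback hm).
  exact: pb_paste tauP (hT.2 _ _ _ _ _ _ _ _ chiP).
have [ch chE] : exists ch : X ~> coalg_Omega, incl ∘ ch = cofree_lift chi.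
  by apply: coalg_eq_factor; rewrite cofree_liftE -e.
have chE' : counit T O ∘ cfun incl ∘ cfun ch = chi.
  exact: incl_lift.
exists ch; split.
  apply: (forget_reflects_pullback L hT).
  apply: (pb_cancel Omega_pullback); last first.
    rewrite -[LHS]/(cfun (ch ∘ m)) -[RHS]/(cfun (coalg_truth ∘ to_top LT U)).
    congr cfun; apply: incl_mono; apply: cofree_ext.
    rewrite ![incl ∘ (_ ∘ _)]comp_assoc [X in X ∘ m]chE.
    rewrite [X in X ∘ to_top _ _]coalg_truthE !cofree_lift_comp chiP.1.
    by congr (_ ∘ _); exact: (to_terminal_uniq topC).
  rewrite chE'.
  have -> : to_top L (carrier (top LT)) ∘ cfun (to_top LT U) =
    to_top L (carrier U) by exact: (to_terminal_uniq topC).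
  exact: chiP.
move=> ch' /(forget_pullback L hT) hP'.
have e' : chi = counit T O ∘ cfun incl ∘ cfun ch'.
  apply: chiU.
  have -> : to_top L (carrier U) = to_top L (carrier (top LT)) ∘
      cfun (to_top LT U) by exact: (to_terminal_uniq topC).
  exact: pb_paste Omega_pullback hP'.
apply: incl_mono; apply: cofree_ext.
rewrite chE cofree_liftE e'; exact: esym (comp_assoc _ _ _).
Qed.

Definition coalg_classifier : SubobjectClassifier LT :=
  {| Omega := coalg_Omega; truth := coalg_truth; classify := coalg_classify |}.
End Classifier.

Definition coalg_topos : ToposStructure (Coalg T) :=
  {| ts_lim := LT; ts_exp := coalg_exponentials; ts_sub := coalg_classifier |}.
End CoalgebraTopos.

(** * Transfer of density to coalgebras *)

(** The small coalgebras enter through a faithful functor [j] and closure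
    properties up to isomorphism, rather than as coalgebras on the objects of
    [C]: this keeps equalities between objects out of the argument. *)
Section Transfer.
Context (C D : Category) (i : Functor C D) (L : FinLimits D) (T : Comonad D).
Context (hT : cartesian_functor T) (K : Category) (j : Functor K (Coalg T)).
Context (full : forall (A B : C) (g : i A ~> i B),
  exists u : A ~> B, fmap i u = g).
Context (sheaf : forall X : D, is_sheaf i X).
Context (eff : forall (I : D) (X : descent_datum i I), effective X).
Context (faithful : forall Q R : K, injective (@fmap _ _ j Q R)).
Context (carrier_small : forall Q : K,
  exists (A : C) (a : i A ~> carrier (j Q)), is_iso a).
Context (cover : forall (X : Coalg T) (Y : C) (f : i Y ~> carrier X),
  exists (Q : K) (g : j Q ~> X) (h : i Y ~> carrier (j Q)), f = cfun g ∘ h).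
Context (small : forall (X : Coalg T) (Q R : K) (g : j Q ~> X) (h : j R ~> X),
  exists (P : K) (p : P ~> Q) (q : P ~> R),
    is_pullback g h (fmap j p) (fmap j q)).

Lemma cover_ext (X : Coalg T) (V : D) (t t' : carrier X ~> V) :
  (forall (Q : K) (g : j Q ~> X), t ∘ cfun g = t' ∘ cfun g) -> t = t'.
Proof.
move=> e; apply: (sheaf_ext (sheaf V)) => Y f.
by have [Q [g [h ->]]] := cover f; rewrite !comp_assoc e.
Qed.

(** Let [phi] be a natural family on the small coalgebras over [I].  It extends to
    a small object over the carrier of [I] by factoring through a covering
    coalgebra; the result is independent of the factorization because two of
    them can be compared over a small pullback.  The glued map is a coalgebra
    map because this can be tested on small coalgebras. *)
Lemma coalg_sheaf (X : Coalg T) : is_sheaf j X.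
Proof.
apply: sheaf_intro => [I g g' e|I phi phin].
  apply: coalgHom_ext; apply: cover_ext => Q h.
  by rewrite -!cfun_comp e.
have wd (Q R : K) (g : j Q ~> I) (h : j R ~> I) (Z : D) (x : Z ~> carrier (j Q))
    (y : Z ~> carrier (j R)) :
    cfun g ∘ x = cfun h ∘ y -> cfun (phi Q g) ∘ x = cfun (phi R h) ∘ y.
  have [P [p [q hP]]] := small g h => e.
  have hU := forget_pullback L hT hP.
  rewrite -[x](gap1 hU e) -[in RHS](gap2 hU e) !comp_assoc -!cfun_comp -!phin.
  by rewrite hP.1.
have ex (Y : C) (f : i Y ~> carrier I) : exists x : i Y ~> carrier X,
    forall (Q : K) (g : j Q ~> I) (h : i Y ~> carrier (j Q)),
    f = cfun g ∘ h -> x = cfun (phi Q g) ∘ h.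
  have [Q [g [h e]]] := cover f; exists (cfun (phi Q g) ∘ h) => R g' h' e'.
  by apply: wd; rewrite -e.
pose psi Y f := proj1_sig (cid (ex Y f)).
have psiE Y f : forall (Q : K) (g : j Q ~> I) (h : i Y ~> carrier (j Q)),
    f = cfun g ∘ h -> psi Y f = cfun (phi Q g) ∘ h := proj2_sig (cid (ex Y f)).
have psin (A B : C) (u : A ~> B) (f : i B ~> carrier I) :
    psi A (f ∘ fmap i u) = psi B f ∘ fmap i u.
  have [Q [g [h e]]] := cover f; rewrite (psiE _ _ _ _ _ e) -comp_assoc.
  by apply: psiE; rewrite e comp_assoc.
have [t ht] := sheaf_glue (sheaf (carrier X)) psin.
have tg (Q : K) (g : j Q ~> I) : t ∘ cfun g = cfun (phi Q g).
  apply: (sheaf_ext (sheaf (carrier X))) => Y y.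
  by rewrite -comp_assoc ht; apply: psiE.
have tc : coact X ∘ t = fmap T t ∘ coact I.
  apply: cover_ext => Q g.
  by rewrite -!comp_assoc tg !cfun_comm !comp_assoc -fmap_comp tg.
exists {| cfun := t; cfun_comm := tc |} => Q g.
by apply: coalgHom_ext; exact: tg.
Qed.

Section Descent.
Context (I : Coalg T) (X : descent_datum j I).

Let UX (Q : K) (g : j Q ~> I) : D := carrier (dd X g).
Let proj (Q : K) (g : j Q ~> I) : UX g ~> carrier (j Q) := cfun (dd_proj X g).
Let map (Q R : K) (u : R ~> Q) (g : j Q ~> I) (g' : j R ~> I)
    (e : g ∘ fmap j u = g') : UX g' ~> UX g := cfun (dd_map X e).

Let map_pullback (Q R : K) (u : R ~> Q) (g : j Q ~> I) (g' : j R ~> I)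
    (e : g ∘ fmap j u = g') :
  is_pullback (cfun (fmap j u)) (proj g) (proj g') (map e).
Proof. exact: (forget_pullback L hT (dd_pullback X e)). Qed.

Let map_comm (Q R : K) (u : R ~> Q) (g : j Q ~> I) (g' : j R ~> I)
    (e : g ∘ fmap j u = g') : cfun (fmap j u) ∘ proj g' = proj g ∘ map e.
Proof. exact: (map_pullback e).1. Qed.

Let map_congr (Q R : K) (u u' : R ~> Q) (g : j Q ~> I) (g' : j R ~> I)
    (e : g ∘ fmap j u = g') (e' : g ∘ fmap j u' = g') :
  fmap j u = fmap j u' -> map e = map e'.
Proof. by move=> /faithful eu; rewrite /map (dd_map_congr X e e' eu). Qed.

Let map_comp (Q R M : K) (u : R ~> Q) (v : M ~> R) (g : j Q ~> I)
    (g' : j R ~> I) (g'' : j M ~> I) (e : g ∘ fmap j u = g')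
    (e' : g' ∘ fmap j v = g'') (e'' : g ∘ fmap j (u ∘ v) = g'') :
  map e ∘ map e' = map e''.
Proof. exact: (congr1 (@cfun _ _ _ _) (dd_comp X e e' e'')). Qed.

(** Generalized elements of two members of the datum are identified when they
    come from a common member; this is the equality of elements in the object
    to be constructed. *)
Let rel (Z : D) (Q R : K) (g : j Q ~> I) (h : j R ~> I) (x : Z ~> UX g)
    (y : Z ~> UX h) : Prop :=
  exists (M : K) (p : M ~> Q) (q : M ~> R) (k : j M ~> I)
    (ep : g ∘ fmap j p = k) (eq : h ∘ fmap j q = k) (w : Z ~> UX k),
    map ep ∘ w = x /\ map eq ∘ w = y.

Let rel_sym (Z : D) (Q R : K) (g : j Q ~> I) (h : j R ~> I) (x : Z ~> UX g)
    (y : Z ~> UX h) : rel x y -> rel y x.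
Proof. by move=> [M [p [q [k [ep [eq [w [e1 e2]]]]]]]]; exists M, q, p, k, eq, ep, w. Qed.

Let rel_map (Q R : K) (u : R ~> Q) (g : j Q ~> I) (g' : j R ~> I)
    (e : g ∘ fmap j u = g') : rel (map e) (idm (UX g')).
Proof.
have e' : g' ∘ fmap j (idm R) = g' by rewrite fmap_id comp_idr.
exists R, u, (idm R), g', e, e', (idm _).
by rewrite /map dd_map_id /= comp_idl comp_idr.
Qed.

Let rel_precomp (Z W : D) (Q R : K) (g : j Q ~> I) (h : j R ~> I) (x : Z ~> UX g)
    (y : Z ~> UX h) (t : W ~> Z) : rel x y -> rel (x ∘ t) (y ∘ t).
Proof.
move=> [M [p [q [k [ep [eq [w [e1 e2]]]]]]]]; exists M, p, q, k, ep, eq, (w ∘ t).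
by rewrite !comp_assoc e1 e2.
Qed.

Let rel_proj (Z : D) (Q R : K) (g : j Q ~> I) (h : j R ~> I) (x : Z ~> UX g)
    (y : Z ~> UX h) :
  rel x y -> cfun g ∘ (proj g ∘ x) = cfun h ∘ (proj h ∘ y).
Proof.
move=> [M [p [q [k [ep [eq [w [<- <-]]]]]]]].
rewrite !(comp_assoc (proj _)) -!map_comm !comp_assoc -!cfun_comp.
by rewrite ep eq.
Qed.

(* The two common members are joined over the small pullback of their maps to
   the middle one. *)
Let rel_trans (Z : D) (Q R S : K) (g : j Q ~> I) (h : j R ~> I) (l : j S ~> I)
    (x : Z ~> UX g) (y : Z ~> UX h) (z : Z ~> UX l) :
  rel x y -> rel y z -> rel x z.
Proof.
move=> [M [p [q [k [ep [eq [w [e1 e2]]]]]]]].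
move=> [N [r [s [k' [er [es [w' [e3 e4]]]]]]]].
have [O [a [b hO]]] := small (fmap j q) (fmap j r).
have hU := forget_pullback L hT hO.
have ew : cfun (fmap j q) ∘ (proj k ∘ w) = cfun (fmap j r) ∘ (proj k' ∘ w').
  rewrite !comp_assoc (map_comm eq) (map_comm er) -!comp_assoc.
  by rewrite e2 e3.
have ea : k ∘ fmap j a = k ∘ fmap j a by [].
have eb : k' ∘ fmap j b = k ∘ fmap j a.
  by rewrite -er -eq -!comp_assoc hO.1.
pose v := gap (map_pullback ea) (gap1 hU ew).
have v2 : map ea ∘ v = w := gap2 (map_pullback ea) (gap1 hU ew).
have v1 : proj _ ∘ v = gap hU ew := gap1 (map_pullback ea) (gap1 hU ew).
have v3 : map eb ∘ v = w'.
  apply: (pullback_jointly_monic (map_pullback er)).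
    by rewrite comp_assoc -(map_comm eb) -comp_assoc v1 gap2.
  have ec : h ∘ fmap j (r ∘ b) = k ∘ fmap j a.
    by rewrite fmap_comp comp_assoc er eb.
  have ec' : h ∘ fmap j (q ∘ a) = k ∘ fmap j a.
    by rewrite fmap_comp comp_assoc eq.
  rewrite e3 -e2 -v2 comp_assoc (map_comp er eb ec) comp_assoc (map_comp eq ea ec').
  congr (_ ∘ v); apply: map_congr.
  by rewrite !fmap_comp hO.1.
have epa : g ∘ fmap j (p ∘ a) = k ∘ fmap j a by rewrite fmap_comp comp_assoc ep.
have esb : l ∘ fmap j (s ∘ b) = k ∘ fmap j a by rewrite fmap_comp comp_assoc es.
exists O, (p ∘ a), (s ∘ b), (k ∘ fmap j a), epa, esb, v; split.
  by rewrite -(map_comp ep ea epa) -comp_assoc v2.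
by rewrite -(map_comp es eb esb) -comp_assoc v3.
Qed.

Let rel_transport (Z : D) (Q R : K) (g : j Q ~> I) (h : j R ~> I) (x : Z ~> UX g)
    (b : Z ~> carrier (j R)) :
  cfun g ∘ (proj g ∘ x) = cfun h ∘ b ->
  exists y : Z ~> UX h, proj h ∘ y = b /\ rel x y.
Proof.
have [O [p [q hO]]] := small g h => e.
have hU := forget_pullback L hT hO.
have eq : h ∘ fmap j q = g ∘ fmap j p by rewrite hO.1.
pose w := gap (map_pullback (erefl (g ∘ fmap j p))) (gap1 hU e).
exists (map eq ∘ w); split.
  rewrite comp_assoc -(map_comm eq) -comp_assoc [X in _ ∘ X]gap1.
  exact: gap2.
exists O, p, q, _, erefl, eq, w; split=> //; exact: gap2.
Qed.

(* Transitivity gives a common member [k] and two maps [p] and [q] from it to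
   [h] that agree on the element in question; it then lifts to the member over
   the equalizer of [p] and [q], where the two induced maps coincide. *)
Let rel_uniq (Z : D) (Q R : K) (g : j Q ~> I) (h : j R ~> I) (x : Z ~> UX g)
    (y y' : Z ~> UX h) :
  rel x y -> rel x y' -> proj h ∘ y = proj h ∘ y' -> y = y'.
Proof.
move=> /rel_sym r1 r2 e; have := rel_trans r1 r2.
move=> [M [p [q [k [ep [eq [w [e1 e2]]]]]]]].
pose LT := coalg_lim L hT.
(* The equalizer is obtained as a pullback of graphs over an arbitrary
   coalgebra, hence is small. *)
pose gp := cpair LT (idm _) (fmap j p); pose gq := cpair LT (idm _) (fmap j q).
have [N [a [b hN]]] := small gp gq.
have hU := forget_pullback L hT hN.
have [_ pa] := graphs_pullback hN.
have ew : cfun gp ∘ (proj k ∘ w) = cfun gq ∘ (proj k ∘ w).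
  apply: (product_jointly_monic (forget_product L hT (@cprod_product _ LT _ _))).
    by rewrite !comp_assoc -!cfun_comp !cpair_fst.
  have sp : cfun (csnd LT _ _) ∘ cfun gp = cfun (fmap j p).
    by rewrite -cfun_comp cpair_snd.
  have sq : cfun (csnd LT _ _) ∘ cfun gq = cfun (fmap j q).
    by rewrite -cfun_comp cpair_snd.
  rewrite !comp_assoc sp sq (map_comm ep) (map_comm eq) -!comp_assoc.
  by rewrite e1 e2.
pose v := gap (map_pullback (erefl (k ∘ fmap j a))) (gap1 hU ew).
have v2 : map (erefl (k ∘ fmap j a)) ∘ v = w :=
  gap2 (map_pullback (erefl (k ∘ fmap j a))) (gap1 hU ew).
have epa : h ∘ fmap j (p ∘ a) = k ∘ fmap j a by rewrite fmap_comp comp_assoc ep.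
have eqa : h ∘ fmap j (q ∘ a) = k ∘ fmap j a by rewrite fmap_comp comp_assoc eq.
rewrite -e1 -e2 -v2 !comp_assoc (map_comp ep (erefl (k ∘ fmap j a)) epa)
  (map_comp eq (erefl (k ∘ fmap j a)) eqa).
congr (_ ∘ v); apply: map_congr.
by rewrite !fmap_comp pa.
Qed.

Section Underlying.

Let cQ (Y : C) (f : i Y ~> carrier I) : K := proj1_sig (cid (cover f)).
Let cg (Y : C) (f : i Y ~> carrier I) : j (cQ f) ~> I :=
  proj1_sig (cid (proj2_sig (cid (cover f)))).
Let ch (Y : C) (f : i Y ~> carrier I) : i Y ~> carrier (j (cQ f)) :=
  proj1_sig (cid (proj2_sig (cid (proj2_sig (cid (cover f)))))).
Let chE (Y : C) (f : i Y ~> carrier I) : cfun (cg f) ∘ ch f = f :=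
  esym (proj2_sig (cid (proj2_sig (cid (proj2_sig (cid (cover f))))))).

Let Xf (Y : C) (f : i Y ~> carrier I) : D := pb L (ch f) (proj (cg f)).
Let pr (Y : C) (f : i Y ~> carrier I) : Xf f ~> i Y := pb1 L (ch f) (proj (cg f)).
Let el (Y : C) (f : i Y ~> carrier I) : Xf f ~> UX (cg f) :=
  pb2 L (ch f) (proj (cg f)).

Let XfP (Y : C) (f : i Y ~> carrier I) :
  is_pullback (ch f) (proj (cg f)) (pr f) (el f) := pb_pullback L _ _.

Let el_proj (Y : C) (f : i Y ~> carrier I) (Z : D) (z : Z ~> Xf f) :
  cfun (cg f) ∘ (proj (cg f) ∘ (el f ∘ z)) = f ∘ (pr f ∘ z).
Proof.
transitivity (cfun (cg f) ∘ ch f ∘ (pr f ∘ z)); last by rewrite chE.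
by rewrite (comp_assoc (proj _)) -(XfP f).1 -!comp_assoc.
Qed.

(* An element of [Xf f] is determined by its projection to [i Y] and by the class
   of its component in the datum. *)
Let el_uniq (Y : C) (f : i Y ~> carrier I) (Z : D) (z z' : Z ~> Xf f)
    (Q : K) (g : j Q ~> I) (x : Z ~> UX g) :
  pr f ∘ z = pr f ∘ z' -> rel x (el f ∘ z) -> rel x (el f ∘ z') -> z = z'.
Proof.
move=> e r r'; apply: (pullback_jointly_monic (XfP f)) => //.
by apply: (rel_uniq r r'); rewrite !comp_assoc -(XfP f).1 -!comp_assoc e.
Qed.

Let el_lift (Y : C) (f : i Y ~> carrier I) (Z : D) (b : Z ~> i Y)
    (Q : K) (g : j Q ~> I) (x : Z ~> UX g) :
  cfun g ∘ (proj g ∘ x) = f ∘ b ->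
  exists z : Z ~> Xf f, pr f ∘ z = b /\ rel x (el f ∘ z).
Proof.
rewrite -{1}(chE f) -comp_assoc => /rel_transport [y [e r]].
by exists (gap (XfP f) (esym e)); rewrite [pr f ∘ _]gap1 [el f ∘ _]gap2.
Qed.

Let mp_ex (J N : C) (u : N ~> J) (f : i J ~> carrier I) (f' : i N ~> carrier I)
    (e : f ∘ fmap i u = f') : exists m : Xf f' ~> Xf f,
  pr f ∘ m = fmap i u ∘ pr f' /\ rel (el f') (el f ∘ m).
Proof.
apply: el_lift; have := el_proj (idm (Xf f')); rewrite !comp_idr => ->.
by rewrite comp_assoc e.
Qed.

Let mp (J N : C) (u : N ~> J) (f : i J ~> carrier I) (f' : i N ~> carrier I)
    (e : f ∘ fmap i u = f') : Xf f' ~> Xf f := proj1_sig (cid (mp_ex e)).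

Let mp_pr (J N : C) (u : N ~> J) (f : i J ~> carrier I) (f' : i N ~> carrier I)
    (e : f ∘ fmap i u = f') : pr f ∘ mp e = fmap i u ∘ pr f' :=
  (proj2_sig (cid (mp_ex e))).1.

Let mp_el (J N : C) (u : N ~> J) (f : i J ~> carrier I) (f' : i N ~> carrier I)
    (e : f ∘ fmap i u = f') : rel (el f') (el f ∘ mp e) :=
  (proj2_sig (cid (mp_ex e))).2.

Let mp_pullback (J N : C) (u : N ~> J) (f : i J ~> carrier I)
    (f' : i N ~> carrier I) (e : f ∘ fmap i u = f') :
  is_pullback (fmap i u) (pr f) (pr f') (mp e).
Proof.
apply: pb_intro; first exact: esym (mp_pr e).
- move=> Z b z ez.
  have [n [e1 r]] : exists n : Z ~> Xf f', pr f' ∘ n = b /\ rel (el f ∘ z) (el f' ∘ n).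
    by apply: el_lift; rewrite el_proj -ez comp_assoc e.
  exists n; split=> //; apply: (el_uniq (x := el f' ∘ n)).
  - by rewrite comp_assoc (mp_pr e) -comp_assoc e1.
  - by rewrite comp_assoc; exact: rel_precomp (mp_el e).
  - exact: rel_sym r.
- move=> Z h k e1 e2; apply: (el_uniq (x := el f ∘ (mp e ∘ h))) => //.
    by rewrite comp_assoc; exact/rel_sym/rel_precomp/(mp_el e).
  by rewrite e2 comp_assoc; exact/rel_sym/rel_precomp/(mp_el e).
Qed.

Let mp_comp (J N M : C) (u : N ~> J) (v : M ~> N) (f : i J ~> carrier I)
    (f' : i N ~> carrier I) (f'' : i M ~> carrier I) (e : f ∘ fmap i u = f')
    (e' : f' ∘ fmap i v = f'') (e'' : f ∘ fmap i (u ∘ v) = f'') :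
  mp e ∘ mp e' = mp e''.
Proof.
apply: (el_uniq (x := el f'')) (mp_el e'').
  rewrite comp_assoc (mp_pr e) (mp_pr e'') -comp_assoc (mp_pr e').
  by rewrite fmap_comp -comp_assoc.
apply: rel_trans (mp_el e') _; rewrite comp_assoc.
exact: rel_precomp (mp_el e).
Qed.

(** The given datum, extended from the small coalgebras over [I] to all the
    small objects over its carrier by pulling back along a covering coalgebra. *)
Let carrier_datum : descent_datum i (carrier I) :=
  {| dd := Xf; dd_proj := pr; dd_map := mp; dd_pullback := mp_pullback;
     dd_comp := mp_comp |}.

(** The extended datum glues in the base.  Since its members are isomorphic to
    those of the given datum whenever both are defined, the latter inherit
    cartesian maps to the glueing, which agree on elements related by [rel]. *)
Lemma underlying_glueing : exists (E : D) (q : E ~> carrier I)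
    (c : forall (Q : K) (g : j Q ~> I), UX g ~> E),
  (forall (Q : K) (g : j Q ~> I), is_pullback (cfun g) q (proj g) (c Q g)) /\
  (forall (Z : D) (Q R : K) (g : j Q ~> I) (h : j R ~> I) (x : Z ~> UX g)
    (y : Z ~> UX h), rel x y -> c Q g ∘ x = c R h ∘ y).
Proof.
have [E [q [c [cP cM]]]] := eff carrier_datum.
have c_rel (J N : C) (f : i J ~> carrier I) (f' : i N ~> carrier I) (Z : D)
    (z : Z ~> Xf f) (z' : Z ~> Xf f') :
    rel (el f ∘ z) (el f' ∘ z') -> c J f ∘ z = c N f' ∘ z'.
  move=> r; apply: (sheaf_ext (sheaf E)) => Y t.
  have {r} := rel_precomp t r; rewrite -!comp_assoc.
  move: (z ∘ t) (z' ∘ t) => {}z {}z' r.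
  have [u eu] := full (pr f ∘ z); have [u' eu'] := full (pr f' ∘ z').
  have [f'' [ef ef']] : exists f'', f ∘ fmap i u = f'' /\ f' ∘ fmap i u' = f''.
    by exists (f ∘ fmap i u); rewrite eu eu' -!el_proj (rel_proj r).
  have l : fmap i u ∘ idm _ = pr f ∘ z by rewrite eu comp_idr.
  have l' : fmap i u' ∘ idm _ = pr f' ∘ z' by rewrite eu' comp_idr.
  pose n := gap (mp_pullback ef) l; pose n' := gap (mp_pullback ef') l'.
  have n2 : mp ef ∘ n = z := gap2 (mp_pullback ef) l.
  have n2' : mp ef' ∘ n' = z' := gap2 (mp_pullback ef') l'.
  have nn : n = n'.
    apply: (el_uniq (x := el f ∘ z)); first by rewrite !gap1.
      by rewrite -{1}n2 comp_assoc; exact/rel_sym/rel_precomp/(mp_el ef).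
    apply: (rel_trans r).
    by rewrite -{1}n2' comp_assoc; exact/rel_sym/rel_precomp/(mp_el ef').
  rewrite -n2 -n2' -nn !comp_assoc.
  by rewrite [X in X ∘ n](cM _ _ _ _ _ ef) -(cM _ _ _ _ _ ef').
(* For [f = cfun g ∘ a] with [a] an isomorphism, [Xf f] is another copy of
   [UX g]. *)
have d_ex (Q : K) (g : j Q ~> I) : exists (A : C) (a : i A ~> carrier (j Q))
    (b : carrier (j Q) ~> i A) (d : UX g ~> Xf (cfun g ∘ a)),
    [/\ b ∘ a = idm _, a ∘ b = idm _, pr _ ∘ d = b ∘ proj g
      & rel (idm (UX g)) (el _ ∘ d)].
  have [A [a [b [ba ab]]]] := carrier_small Q; exists A, a, b.
  have [|d [d1 d2]] := @el_lift _ (cfun g ∘ a) _ (b ∘ proj g) _ g (idm _).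
    by rewrite comp_idr -[RHS]comp_assoc (comp_assoc a) ab comp_idl.
  by exists d.
have C_ex (Q : K) (g : j Q ~> I) : exists k : UX g ~> E,
    is_pullback (cfun g) q (proj g) k /\
    forall (Z : D) (x : Z ~> UX g) (J : C) (f : i J ~> carrier I) (z : Z ~> Xf f),
      rel x (el f ∘ z) -> k ∘ x = c J f ∘ z.
  have [A [a [b [d [ba ab d1 d2]]]]] := d_ex Q g.
  have kE (Z : D) (x : Z ~> UX g) (J : C) (f : i J ~> carrier I) (z : Z ~> Xf f) :
      rel x (el f ∘ z) -> c _ _ ∘ d ∘ x = c J f ∘ z.
    move=> r; rewrite -comp_assoc; apply: c_rel; apply: rel_trans r.
    by apply: rel_sym; have := rel_precomp x d2; rewrite comp_idl comp_assoc.
  exists (c _ _ ∘ d); split=> //; apply: pb_intro.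
  - rewrite comp_assoc -(cP _ _).1 -comp_assoc [X in _ = _ ∘ X]d1.
    by rewrite -comp_assoc (comp_assoc a) ab comp_idl.
  - move=> Z z1 z2 e.
    have e' : (cfun g ∘ a) ∘ (b ∘ z1) = q ∘ z2.
      by rewrite -comp_assoc (comp_assoc a) ab comp_idl.
    pose n := gap (cP _ _) e'.
    have n1 : pr _ ∘ n = b ∘ z1 := gap1 (cP _ _) e'.
    have n2 : c _ _ ∘ n = z2 := gap2 (cP _ _) e'.
    have [|x [x1 x2]] := @rel_transport _ _ _ _ g (el _ ∘ n) z1.
      by rewrite el_proj n1 -comp_assoc (comp_assoc a) ab comp_idl.
    by exists x; rewrite -n2; split=> //; exact/kE/rel_sym.
  - move=> Z h k e1; rewrite -!comp_assoc => e2.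
    have e : d ∘ h = d ∘ k.
      apply: (pullback_jointly_monic (cP _ _)) => //.
      by rewrite !comp_assoc d1 -!comp_assoc e1.
    have rh (t : Z ~> UX g) : rel (el _ ∘ (d ∘ t)) t.
      by apply: rel_sym; have := rel_precomp t d2; rewrite comp_idl comp_assoc.
    by have rk := rh k; rewrite -e in rk; exact: rel_uniq (rh h) rk e1.
exists E, q, (fun Q g => proj1_sig (cid (C_ex Q g))); split.
  by move=> Q g; case: cid => k [].
move=> Z Q R g h x y r; case: cid => k [kP kE]; case: cid => k' [kP' kE'].
apply: (sheaf_ext (sheaf E)) => Y t.
have [z [_ rz]] : exists z : i Y ~> Xf (cfun g ∘ (proj g ∘ (x ∘ t))),
    pr _ ∘ z = idm _ /\ rel (x ∘ t) (el _ ∘ z).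
  by apply: el_lift; rewrite comp_idr.
rewrite -!comp_assoc (kE _ _ _ _ _ rz); apply: esym; apply: kE'.
exact: rel_trans (rel_sym (rel_precomp t r)) rz.
Qed.
End Underlying.

(** The glueing [E] carries the coaction that makes all the maps [UX g ~> E]
    coalgebra maps: it exists since [T E] is a sheaf and every element of [E]
    comes from some [UX g], uniquely up to [rel].  All equations to be checked
    hold after composition with these jointly epic maps. *)
Lemma coalg_effective : effective X.
Proof.
have [E [q [c [cP cR]]]] := underlying_glueing.
have cM (Q R : K) (u : R ~> Q) (g : j Q ~> I) (g' : j R ~> I)
    (e : g ∘ fmap j u = g') : c Q g ∘ map e = c R g'.
  by rewrite (cR _ _ _ _ _ _ _ (rel_map e)) comp_idr.
have c_cover (Y : C) (z : i Y ~> E) : exists (Q : K) (g : j Q ~> I)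
    (x : i Y ~> UX g), z = c Q g ∘ x.
  have [Q [g [h e]]] := cover (q ∘ z).
  by exists Q, g, (gap (cP Q g) (esym e)); rewrite gap2.
have c_epi (V : D) (t t' : E ~> V) :
    (forall (Q : K) (g : j Q ~> I), t ∘ c Q g = t' ∘ c Q g) -> t = t'.
  move=> e; apply: (sheaf_ext (sheaf V)) => Y z.
  by have [Q [g [x ->]]] := c_cover Y z; rewrite !comp_assoc e.
have c_rel (Z : D) (Q R : K) (g : j Q ~> I) (h : j R ~> I) (x : Z ~> UX g)
    (y : Z ~> UX h) : c Q g ∘ x = c R h ∘ y -> rel x y.
  move=> e; have [|y' [y1 y2]] := @rel_transport _ _ _ g h x (proj h ∘ y).
    by rewrite !comp_assoc !(cP _ _).1 -!comp_assoc e.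
  suff <- : y' = y by [].
  by apply: (pullback_jointly_monic (cP R h)) => //; rewrite -(cR _ _ _ _ _ _ _ y2).
pose w Q (g : j Q ~> I) : UX g ~> T E := fmap T (c Q g) ∘ coact (dd X g).
have w_rel (Z : D) (Q R : K) (g : j Q ~> I) (h : j R ~> I) (x : Z ~> UX g)
    (y : Z ~> UX h) : rel x y -> w Q g ∘ x = w R h ∘ y.
  move=> [M [p [r [k [ep [er [v [<- <-]]]]]]]].
  have wM (S : K) (l : j S ~> I) (o : M ~> S) (eo : l ∘ fmap j o = k) :
      w S l ∘ map eo = w M k.
    rewrite /w -comp_assoc [X in _ ∘ X](cfun_comm (dd_map X eo)) comp_assoc.
    by rewrite -fmap_comp (cM _ _ _ _ _ eo).
  by rewrite !comp_assoc !wM.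
have psi_ex (Y : C) (z : i Y ~> E) : exists v : i Y ~> T E,
    forall (Q : K) (g : j Q ~> I) (x : i Y ~> UX g), z = c Q g ∘ x ->
    v = w Q g ∘ x.
  have [Q [g [x e]]] := c_cover Y z; exists (w Q g ∘ x) => R h y e'.
  by apply/w_rel/c_rel; rewrite -e.
pose psi Y z := proj1_sig (cid (psi_ex Y z)).
have psiE Y z : forall (Q : K) (g : j Q ~> I) (x : i Y ~> UX g), z = c Q g ∘ x ->
  psi Y z = w Q g ∘ x := proj2_sig (cid (psi_ex Y z)).
have psin (A B : C) (u : A ~> B) (z : i B ~> E) :
    psi A (z ∘ fmap i u) = psi B z ∘ fmap i u.
  have [Q [g [x e]]] := c_cover B z; rewrite (psiE _ _ _ _ _ e) -comp_assoc.
  by apply: psiE; rewrite e comp_assoc.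
have [a ha] := sheaf_glue (sheaf (T E)) psin.
have ac (Q : K) (g : j Q ~> I) : a ∘ c Q g = fmap T (c Q g) ∘ coact (dd X g).
  apply: (sheaf_ext (sheaf (T E))) => Y x.
  by rewrite -comp_assoc ha; apply: psiE.
have a1 : counit T E ∘ a = idm E.
  apply: c_epi => Q g; rewrite -comp_assoc ac comp_assoc counit_nat.
  by rewrite -comp_assoc coact_counit comp_idl comp_idr.
have a2 : comult T E ∘ a = fmap T a ∘ a.
  apply: c_epi => Q g.
  transitivity (fmap T (fmap T (c Q g)) ∘
      (fmap T (coact (dd X g)) ∘ coact (dd X g))).
    by rewrite -[LHS]comp_assoc ac comp_assoc comult_nat -comp_assoc coact_comult.
  rewrite -[RHS]comp_assoc ac [RHS]comp_assoc -(fmap_comp T a) ac fmap_comp.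
  by rewrite -comp_assoc.
pose Ec : Coalg T := {| carrier := E; coact := a; coact_counit := a1;
  coact_comult := a2 |}.
have qc : coact I ∘ q = fmap T q ∘ coact Ec.
  apply: c_epi => Q g; rewrite -!comp_assoc [X in _ = _ ∘ X]ac -(cP Q g).1.
  rewrite comp_assoc cfun_comm -comp_assoc [X in _ ∘ X](cfun_comm (dd_proj X g)).
  by rewrite !comp_assoc -!fmap_comp (cP Q g).1.
pose qh : Ec ~> I := {| cfun := q : carrier Ec ~> carrier I; cfun_comm := qc |}.
pose chom Q (g : j Q ~> I) : dd X g ~> Ec :=
  {| cfun := c Q g : carrier (dd X g) ~> carrier Ec; cfun_comm := ac Q g |}.
exists Ec, qh, chom; split=> [Q g|Q R u g g' e].
  exact/(forget_reflects_pullback L hT)/cP.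
by apply: coalgHom_ext; exact: cM.
Qed.
End Descent.
End Transfer.

(** * Power objects and locally small maps *)

Definition jointly_monic (C : Category) (X A B : C) (a : X ~> A) (b : X ~> B) :
    Prop :=
  forall (Z : C) (h k : Z ~> X), a ∘ h = a ∘ k -> b ∘ h = b ∘ k -> h = k.

Section RelativePower.
Context (C : Category) (S : ToposStructure C).
Let L := ts_lim S.
Context (E B : C) (p : E ~> B).

(** A weakly universal family of subobjects of the fibres of [p].  The base [B2]
    is [B * Omega^E], and [E2] is the set of triples of [b], [S] and [e] with
    [p e = b] and [e] in [S].  A family of subobjects of fibres indexed by [f]
    is in particular a family of subobjects of [E], classified by a map to
    [Omega^E]. *)
Lemma relative_power : exists (E2 B2 : C) (r : B2 ~> B) (s : E2 ~> E)
    (p2 : E2 ~> B2),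
  [/\ r ∘ p2 = p ∘ s, jointly_monic p2 s &
    forall (X Y : C) (q : X ~> Y) (f : Y ~> B) (g : X ~> E),
      f ∘ q = p ∘ g -> jointly_monic q g ->
      exists (f2 : Y ~> B2) (g2 : X ~> E2), is_pullback f2 p2 q g2].
Proof.
pose PE := expo (ts_exp S) E (Omega (ts_sub S)).
pose e := ev (ts_exp S) E (Omega (ts_sub S)).
pose B2 := cprod L B PE.
pose w1 := pb1 L p (cfst L B PE); pose w2 := pb2 L p (cfst L B PE).
have hW : is_pullback p (cfst L B PE) w1 w2 := pb_pullback L _ _.
pose th := cpair L (csnd L B PE ∘ w2) w1.
pose t := pb1 L (e ∘ th) (truth (ts_sub S)).
have hE : is_pullback (e ∘ th) (truth (ts_sub S)) t (pb2 L _ _) :=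
  pb_pullback L _ _.
have ht : monic t.
  move=> Z h k ek; apply: (pullback_jointly_monic hE) => //.
  exact: (to_terminal_uniq (top_terminal L)).
have hs : jointly_monic (w2 ∘ t) (w1 ∘ t).
  move=> Z h k e2 e1; apply: ht.
  by apply: (pullback_jointly_monic hW); rewrite !comp_assoc.
exists (pb L (e ∘ th) (truth (ts_sub S))), B2, (cfst L B PE), (w1 ∘ t), (w2 ∘ t).
split=> //; first by rewrite !comp_assoc hW.1.
move=> X Y q f g efg hqg.
have hm : monic (cpair L q g).
  move=> Z h k; rewrite !cpair_comp => ehk; apply: hqg.
    by rewrite -(cpair_fst L (q ∘ h) (g ∘ h)) ehk cpair_fst.
  by rewrite -(cpair_snd L (q ∘ h) (g ∘ h)) ehk cpair_snd.
have [chi [chiP _]] := classify (ts_sub S) hm.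
have [k [ek _]] := exp_universal (ts_exp S) chi.
pose f2 := cpair L f k.
have chiE (Z : C) (y : Z ~> Y) (x : Z ~> E) :
    chi ∘ cpair L y x = e ∘ cpair L (k ∘ y) x.
  rewrite -ek -comp_assoc; congr (_ ∘ _); rewrite /prod_map cpair_comp.
  by rewrite -comp_assoc cpair_fst cpair_snd.
have el : p ∘ g = cfst L B PE ∘ (f2 ∘ q) by rewrite comp_assoc cpair_fst efg.
pose l := gap hW el.
have eg2 : (e ∘ th) ∘ l = truth (ts_sub S) ∘ to_top L X.
  rewrite -chiP.1 chiE -comp_assoc; congr (_ ∘ _); rewrite cpair_comp.
  by rewrite gap1 -comp_assoc gap2 comp_assoc cpair_snd.
pose g2 := gap hE eg2.
have g2t : t ∘ g2 = l := gap1 hE eg2.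
exists f2, g2; apply: pb_intro.
- by rewrite -comp_assoc g2t gap2.
- move=> Z z1 z2 ez.
  have ex : chi ∘ cpair L z1 (w1 ∘ t ∘ z2) = truth (ts_sub S) ∘ (pb2 L _ _ ∘ z2).
    rewrite chiE [RHS]comp_assoc -hE.1 -!comp_assoc; congr (_ ∘ _).
    rewrite cpair_comp; congr cpair.
    by rewrite -(cpair_snd L f k) -!comp_assoc ez -comp_assoc.
  pose x := gap chiP ex.
  have xE : cpair L q g ∘ x = cpair L z1 (w1 ∘ t ∘ z2) := gap1 chiP ex.
  have xq : q ∘ x = z1.
    by rewrite -(cpair_fst L q g) -comp_assoc xE cpair_fst.
  have xg : g ∘ x = w1 ∘ t ∘ z2.
    by rewrite -(cpair_snd L q g) -comp_assoc xE cpair_snd.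
  exists x; split=> //; apply: hs.
    rewrite -ez -xq [RHS]comp_assoc [LHS]comp_assoc; congr (_ ∘ x).
    by rewrite -comp_assoc g2t; exact: gap2.
  rewrite -xg comp_assoc; congr (_ ∘ x).
  by rewrite -comp_assoc g2t; exact: gap1.
- move=> Z h h' eq /(congr1 (comp (w1 ∘ t))).
  by rewrite !(comp_assoc (w1 ∘ t)) -(comp_assoc w1) g2t gap1; exact: hqg.
Qed.
End RelativePower.

Section LogicalSubtopos.
Context (C D : Category) (i : Functor C D) (hi : logical_subtopos i).

(** The classifying map of the subobject is a map between small objects, whose
    chosen pullback along [truth] is small. *)
Lemma subobject_small (U V : D) (m : U ~> V) : in_image i V -> monic m ->
  exists (A : C) (k : i A ~> U), is_iso k.
Proof.
move=> hV hm; have [_ [S [S1 S2 _ S4]]] := hi.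
have [chi [chiP _]] := classify (ts_sub S) hm.
have [A eA] := S2 _ _ _ chi (truth (ts_sub S)) hV S1 S4.
have [k [hk _ _]] := pb_compare chiP (pb_pullback (ts_lim S) _ _).
by exists A; rewrite eA; exists k.
Qed.

Lemma pullback_small (A B X : D) (f : A ~> X) (g : B ~> X) :
  in_image i A -> in_image i B -> in_image i X ->
  exists (P : C) (p1 : i P ~> A) (p2 : i P ~> B), is_pullback f g p1 p2.
Proof.
move=> hA hB hX; have [_ [S [_ S2 _ _]]] := hi.
have [P eP] := S2 _ _ _ f g hA hB hX; exists P; rewrite eP.
by exists (pb1 _ f g), (pb2 _ f g); exact: pb_pullback.
Qed.

Lemma locally_small_pullback (E B E' B' : D) (p : E ~> B) (p' : E' ~> B')
    (f : B' ~> B) (g : E' ~> E) :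
  is_pullback f p p' g -> locally_small i p -> locally_small i p'.
Proof.
move=> hP hp A a; have [P [q [r hQ]]] := hp A (f ∘ a).
have e : f ∘ (a ∘ q) = p ∘ r by rewrite comp_assoc hQ.1.
exists P, q, (gap hP e); apply: (pb_cancel hP); rewrite ?gap2 ?gap1 //.
Qed.

Lemma locally_small_sub (L : FinLimits D) (E B E' : D) (p : E ~> B)
    (s : E' ~> E) :
  locally_small i p -> monic s -> locally_small i (p ∘ s).
Proof.
move=> hp hs A a; have [P [q [r hP]]] := hp A a.
have hW := pb_pullback L a (p ∘ s).
set w1 := pb1 L _ _ in hW; set w2 := pb2 L _ _ in hW.
have e : a ∘ w1 = p ∘ (s ∘ w2) by rewrite hW.1 comp_assoc.
have hm : monic (gap hP e).
  move=> Z h k ek; apply: (pullback_jointly_monic hW).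
    by rewrite -(gap1 hP e) -!comp_assoc ek.
  by apply: hs; rewrite !comp_assoc -(gap2 hP e) -!comp_assoc ek.
have [A' [k hk]] := subobject_small (ex_intro _ P erefl) hm.
by exists A', (w1 ∘ k), (w2 ∘ k); exact: pb_precomp_iso.
Qed.
End LogicalSubtopos.

(** * The inclusion of coalgebras *)

Lemma heq_faithful (C D : Category) (F : Functor C D) (A B A' B' : C)
    (f : A ~> B) (g : A' ~> B') :
  (forall X Y : C, injective (@fmap _ _ F X Y)) ->
  A = A' -> B = B' -> heq (fmap F f) (fmap F g) -> heq f g.
Proof.
move=> ff eA eB; case: _ / eA g => g; case: _ / eB g => g /heq_eq/ff ->.
exact: heq_refl.
Qed.

Definition level_cartesian (E : NDiagram) (B : NComonad E) (n : nat) :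
  cartesian_functor (level B n) := nf_cart B n.

Section Inclusion.
Context (E : NDiagram) (B : NComonad E) (m n : nat) (h : (m <= n)%N).
Let i := tr E h.
Let j := coalg_tr B h.
Context (hi : full_inclusion i).

Let faithful (X Y : E m) : injective (@fmap _ _ i X Y).
Proof. exact: bij_inj (hi.2 X Y). Qed.

Let full (X Y : E m) (g : i X ~> i Y) : exists u : X ~> Y, fmap i u = g.
Proof. by have [k _ ik] := hi.2 X Y; exists (k g). Qed.

Lemma coalg_tr_coact (Q : Coalg (level B m)) :
  heq (coact (j Q)) (fmap i (coact Q)).
Proof. exact: heq_idtol. Qed.

Lemma coalg_tr_faithful (Q R : Coalg (level B m)) :
  injective (@fmap _ _ j Q R).
Proof.
by move=> f g e; apply/coalgHom_ext/faithful; exact: (congr1 (@cfun _ _ _ _) e).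
Qed.

Lemma coalg_tr_full (Q R : Coalg (level B m)) (g : j Q ~> j R) :
  exists u : Q ~> R, fmap j u = g.
Proof.
have [u eu] := full (cfun g).
have hu : coact R ∘ u = fmap (level B m) u ∘ coact Q.
  apply: faithful; apply: heq_eq; rewrite !fmap_comp.
  have e1 : heq (fmap i (coact R) ∘ fmap i u) (coact (j R) ∘ cfun g).
    by rewrite eu; apply: heq_comp => //; exact/heq_sym/coalg_tr_coact.
  have e2 : heq (fmap i (fmap (B m) u) ∘ fmap i (coact Q))
      (fmap (B n) (cfun g) ∘ coact (j Q)).
    rewrite -eu; apply: heq_comp; first exact: comm_ob.
      exact: comm_hom.
    exact/heq_sym/coalg_tr_coact.
  apply: (heq_trans e1); move: (heq_sym e2); apply: heq_trans; apply: eq_heq.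
  exact: cfun_comm.
by exists {| cfun := u; cfun_comm := hu |}; apply: coalgHom_ext.
Qed.

Lemma coalg_tr_inj : injective j.
Proof.
move=> Q R e; have ec : carrier Q = carrier R.
  exact: (hi.1 _ _ (congr1 (@carrier _ _) e)).
apply: coalg_ob_eq => //; apply: (heq_faithful (F := i)) => //.
  by rewrite ec.
apply: heq_trans (heq_sym (coalg_tr_coact Q)) (heq_trans _ (coalg_tr_coact R)).
by rewrite e.
Qed.

Lemma coalg_tr_full_inclusion : full_inclusion j.
Proof.
split; first exact: coalg_tr_inj.
move=> Q R; exists (fun g => proj1_sig (cid (coalg_tr_full g))).
  by move=> u; apply: coalg_tr_faithful; case: cid.
by move=> g; case: cid.
Qed.

(** The coaction lies between objects in the image of the full functor [i], hence
    comes from level [m], where the coalgebra laws hold since [i] is faithful. *)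
Lemma coalg_tr_image (X : Coalg (level B n)) :
  in_image i (carrier X) -> in_image j X.
Proof.
case: X => V a h1 h2 [A /= e]; case: _ / e a h1 h2 => a h1 h2.
have [b eb] := full (idto (esym (comm_ob B h A)) ∘ a).
have hb : heq (fmap i b) a by rewrite eb; exact: heq_idtol.
have k1 : counit (level B m) A ∘ b = idm A.
  apply: faithful; apply: heq_eq; rewrite fmap_comp fmap_id -h1.
  apply: heq_comp => //; first exact: comm_ob.
  exact/heq_sym/(nm_compat (ncounit B) h).
have k2 : comult (level B m) A ∘ b = fmap (level B m) b ∘ b.
  apply: faithful; apply: heq_eq; rewrite !fmap_comp.
  have e1 : heq (fmap i (ncomult B m A) ∘ fmap i b) (ncomult B n (i A) ∘ a).
    apply: heq_comp => //; first exact: comm_ob.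
    exact/heq_sym/(nm_compat (ncomult B) h).
  have e2 : heq (fmap i (fmap (B m) b) ∘ fmap i b) (fmap (B n) a ∘ a).
    apply: heq_comp => //; first exact: comm_ob.
    exact: heq_trans (comm_hom B h b) (heq_fmap (B n) hb).
  apply: (heq_trans e1); move: (heq_sym e2); apply: heq_trans; apply: eq_heq.
  exact: h2.
exists (@Build_CoalgOb _ (level B m) A b k1 k2).
apply: coalg_ob_eq => //; apply: heq_trans hb; exact: coalg_tr_coact.
Qed.

Lemma coalg_tr_carrier (X : Coalg (level B n)) :
  in_image j X -> in_image i (carrier X).
Proof. by move=> [Q <-]; exists (carrier Q). Qed.

Lemma coalg_tr_small (X : Coalg (level B n)) (A : E m) (k : i A ~> carrier X) :
  is_iso k -> exists (Q : Coalg (level B m)) (l : j Q ~> X), is_iso l.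
Proof.
move=> /coalg_transport [Y [e [l [_ hl]]]].
have [Q eQ] : in_image j Y by apply: coalg_tr_image; exists A.
by exists Q; rewrite eQ; exists l.
Qed.

Lemma coalg_tr_cartesian : cartesian_functor i -> cartesian_functor j.
Proof.
move=> [i1 i2]; split.
  move=> Q /(forget_terminal (cc_lim (E m)) (level_cartesian B m))/i1 hQ.
  exact: (forget_reflects_terminal (level_cartesian B n)).
move=> Q R X f g P p1 p2 /(forget_pullback (cc_lim (E m)) (level_cartesian B m))/i2 hP.
exact: (forget_reflects_pullback (cc_lim (E n)) (level_cartesian B n)).
Qed.
End Inclusion.

(** * The stratification of coalgebras *)

Section Stratification.
Context (E : NDiagram) (B : NComonad E) (m n : nat) (h : (m <= n)%N).
Let i := tr E h.
Let j := coalg_tr B h.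
Let L := cc_lim (E n).
Let hT := level_cartesian B n.
Let LT := coalg_lim L hT.
Context (hi : logical_subtopos i).
Context (hB : morphism_of_sites i i (B n)).

Let box_image (V : E n) : in_image i V -> in_image i (B n V).
Proof. by move=> [A <-]; exists (B m A); exact: comm_ob. Qed.

Lemma coalg_logical_subtopos : logical_subtopos j.
Proof.
split; first exact: coalg_tr_full_inclusion hi.1.
have [_ [S [S1 S2 S3 S4]]] := hi.
exists (coalg_topos S hT).
have img (X : Coalg (level B n)) : in_image i (carrier X) -> in_image j X.
  exact: coalg_tr_image hi.1 _.
have pbI (X Y Z : Coalg (level B n)) (f : X ~> Z) (g : Y ~> Z) :
    in_image j X -> in_image j Y -> in_image j Z ->
    in_image j (pb (coalg_lim (ts_lim S) hT) f g).
  move=> /coalg_tr_carrier hX /coalg_tr_carrier hY /coalg_tr_carrier hZ.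
  by apply: img; exact: S2.
have topI : in_image j (top (coalg_lim (ts_lim S) hT)) by exact: img.
have eqI (X : Coalg (level B n)) (V : E n) (a b : carrier X ~> V) :
    in_image j X -> in_image i V -> in_image j (coalg_eq (ts_lim S) hT a b).
  move=> hX hV.
  have hY : in_image j (cprod (coalg_lim (ts_lim S) hT) X (cofree (level B n) V)).
    by apply: pbI => //; apply: img; exact: box_image.
  exact: pbI.
split=> //.
  move=> X Y /coalg_tr_carrier hX /coalg_tr_carrier hY; apply: eqI.
    by apply: img; apply: box_image; exact: S3.
  by apply: S3 => //; exact: box_image.
apply: eqI => //; apply: img; exact: box_image.
Qed.

(** The comonad being a morphism of sites, the composite of [f] with the coaction
    factors through some [T g], and then [f] itself factors through the
    pullback of the cofree map on [g] along the coaction. *)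
Lemma coalg_cover (X : Coalg (level B n)) (Y : E m) (f : i Y ~> carrier X) :
  exists (Q : Coalg (level B m)) (g : j Q ~> X) (k : i Y ~> carrier (j Q)),
    f = cfun g ∘ k.
Proof.
have [A [g [k e]]] := hB.2 (carrier X) Y (coact X ∘ f).
pose u := coact_map X; pose v := cofree_map (level B n) g.
have hP := pb_pullback LT u v.
have hm : monic (cfun (pb2 LT u v)) := forget_monic L hT 
  (pb_monic hP (@coact_map_monic _ _ X)).
have [A' [a ha]] := subobject_small hi (box_image (ex_intro _ A erefl)) hm.
have [Q [l hl]] := coalg_tr_small hi.1 ha.
have hU := forget_pullback L hT hP.
have e' : cfun u ∘ f = cfun v ∘ k := e.
exists Q, (pb1 LT u v ∘ l), (iso_inv (coalg_iso_cfun hl) ∘ gap hU e').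
by rewrite cfun_comp -comp_assoc (comp_assoc (cfun l)) iso_invr comp_idl gap1.
Qed.

(** The pullback is a subobject of the product of the two small coalgebras. *)
Lemma coalg_pullback_small (X : Coalg (level B n)) (Q R : Coalg (level B m))
    (f : j Q ~> X) (g : j R ~> X) :
  exists (P : Coalg (level B m)) (p : P ~> Q) (q : P ~> R),
    is_pullback f g (fmap j p) (fmap j q).
Proof.
have [_ [S [S1 S2 _ _]]] := hi.
have hP := pb_pullback LT f g; have hU := forget_pullback L hT hP.
pose mm := cpair (ts_lim S) (cfun (pb1 LT f g)) (cfun (pb2 LT f g)).
have hm : monic mm.
  move=> Z a b; rewrite !cpair_comp => e; apply: (pullback_jointly_monic hU).
    have := congr1 (comp (cfst (ts_lim S) _ _)) e.
    by rewrite !cpair_fst.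
  have := congr1 (comp (csnd (ts_lim S) _ _)) e.
  by rewrite !cpair_snd.
have hV : in_image i (cprod (ts_lim S) (carrier (j Q)) (carrier (j R))).
  by apply: S2 => //; [exists (carrier Q)|exists (carrier R)].
have [A [a ha]] := subobject_small hi hV hm.
have [P [l hl]] := coalg_tr_small hi.1 ha.
have [p ep] := coalg_tr_full hi.1 (pb1 LT f g ∘ l).
have [q eq] := coalg_tr_full hi.1 (pb2 LT f g ∘ l).
by exists P, p, q; rewrite ep eq; exact: pb_precomp_iso.
Qed.

(** Pullbacks along maps of coalgebras are computed on carriers; conversely, by
    the covering property, a pullback along an arbitrary map from a small object
    is a pullback of one along a map of coalgebras. *)
Lemma locally_small_carrier (X Y : Coalg (level B n)) (p : X ~> Y) :
  locally_small j p <-> locally_small i (cfun p).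
Proof.
split=> [hp A f|hp Q f].
  have [Q [g [k ->]]] := coalg_cover f.
  have [P [q [r /(forget_pullback L hT) hP]]] := hp Q g.
  have [P' [q' [r' hP']]] := pullback_small hi k (cfun q)
    (ex_intro _ A erefl) (ex_intro _ (carrier P) erefl)
    (ex_intro _ (carrier Q) erefl).
  by exists P', q', (cfun r ∘ r'); exact: pb_paste hP hP'.
have [A [q [r hA]]] := hp (carrier Q) (cfun f).
have hP := pb_pullback LT f p.
have [k [hk _ _]] := pb_compare (forget_pullback L hT hP) hA.
have [P [l hl]] := coalg_tr_small hi.1 hk.
by exists P, (pb1 LT f p ∘ l), (pb2 LT f p ∘ l); exact: pb_precomp_iso.
Qed.

(** A map from a small object to [B n Y] factors through some [B n] of a map with
    small source, along which the pullback is [B n] of a small object. *)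
Lemma box_locally_small (X Y : E n) (p : X ~> Y) :
  locally_small i p -> locally_small i (fmap (B n) p).
Proof.
move=> hp A f; have [A' [g [k ->]]] := hB.2 Y A f.
have [P [q [r /(nf_cart B n).2 hP]]] := hp A' g.
have [P' [q' [r' hP']]] := pullback_small hi k (fmap (B n) q)
  (ex_intro _ A erefl) (box_image (ex_intro _ P erefl))
  (box_image (ex_intro _ A' erefl)).
by exists P', q', (fmap (B n) r ∘ r'); exact: pb_paste hP hP'.
Qed.

(** The relative power object of the cofree map on the generic map is generic for
    coalgebras. *)
Lemma coalg_generic (S : ToposStructure (E n)) :
  (exists (X Y : E n) (p : X ~> Y), generic_locally_small i p) ->
  exists (X Y : Coalg (level B n)) (p : X ~> Y), generic_locally_small j p.
Proof.
move=> [E0 [B0 [p [hp gp]]]].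
pose P := cofree_map (level B n) p.
have [E2 [B2 [r [s [p2 [e2 jm univ]]]]]] := relative_power (coalg_topos S hT) P.
exists E2, B2, p2; split.
  apply/locally_small_carrier.
  have hP := pb_pullback LT P r; have hU := pb_sym (forget_pullback L hT hP).
  have -> : p2 = pb2 LT P r ∘ gap hP (esym e2) by rewrite gap2.
  rewrite cfun_comp; apply: (locally_small_sub hi L).
    apply: (locally_small_pullback hU); exact: box_locally_small.
  apply: (forget_monic L hT) => Z a b eab; apply: jm.
    by rewrite -(gap2 hP (esym e2)) -!comp_assoc eab.
  by rewrite -(gap1 hP (esym e2)) -!comp_assoc eab.
move=> X Y q /locally_small_carrier/gp [f [g hfg]].
apply: (univ X Y q (cofree_lift f) (cofree_lift g)).
  apply: cofree_ext; rewrite cofree_lift_comp hfg.1.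
  rewrite [RHS]comp_assoc [X in _ = X ∘ _](counit_nat (level B n) p).
  by rewrite -comp_assoc; congr (_ ∘ _); apply: esym; exact: cofree_liftE.
move=> Z a b e1 e2'; apply: coalgHom_ext; apply: (pullback_jointly_monic hfg).
  exact: (congr1 (@cfun _ _ _ _) e1).
by rewrite -!(cofree_lift_comp g) e2'.
Qed.

Lemma coalg_dense :
  dense_logical_subtopos i ->
  @dense_logical_subtopos (Coalg (level B m)) (coalg_diagram B n) j.
Proof.
move=> [_ hsheaf hstack].
have full (A A' : E m) (g : i A ~> i A') : exists u, fmap i u = g.
  by have [k _ ik] := hi.1.2 A A'; exists (k g).
have small (Q : Coalg (level B m)) : exists (A : E m) (a : i A ~> carrier (j Q)),
    is_iso a.
  by exists (carrier Q), (idm _); exact: iso_idm.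
have eff (I : E n) (X : descent_datum i I) : effective X.
  exact: stack_effective hstack.
split; first exact: coalg_logical_subtopos.
  exact: (coalg_sheaf L hT hsheaf coalg_cover coalg_pullback_small).
apply: effective_stack.
- exact: (coalg_tr_full hi.1).
- exact: (coalg_sheaf L hT hsheaf coalg_cover coalg_pullback_small).
- move=> I X; exact: (coalg_effective L hT full hsheaf eff
    (coalg_tr_faithful hi.1) small coalg_cover coalg_pullback_small X).
Qed.
End Stratification.

Theorem theorem3p19 (E : NDiagram) (hE : stratified_topos E)
    (B : NComonad E) (hB : stratified_cartesian B) :
  stratified_topos (coalg_diagram B).
Proof.
have [[htop hcart] hdense hgen] := hE.
have logical (m n : nat) (h : (m <= n)%N) : logical_subtopos (tr E h).
  by have [] := hdense m n h.
split.
- split=> [n|m n h].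
    have [[e] [s]] := htop n; pose S := Build_ToposStructure e s.
    split; constructor.
      exact: (ts_exp (coalg_topos S (level_cartesian B n))).
    exact: (ts_sub (coalg_topos S (level_cartesian B n))).
  exact/coalg_tr_cartesian/hcart.
- move=> m n h; exact: coalg_dense (hB m n h) (hdense m n h).
- move=> m n h hmn; have [[e] [s]] := htop n.
  exact: (coalg_generic (logical m n h) (hB m n h) (Build_ToposStructure e s)
    (hgen m n h hmn)).
Qed.
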